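(* Let $((F,\nu,N),[\cdot,\cdot]_{F,h},(\rho,\eta))$ be a generalized Lie algebroid, $(E,\pi,M)$ a vector bundle with dual $(E^*,\overset{*}{\pi},M)$, and $(\overset{*}{g},h)$ a locally invertible vector bundle morphism from $(E^*,\overset{*}{\pi},M)$ to $(F,\nu,N)$. Let $\overset{*}{u}\in\Gamma(E^*,\overset{*}{\pi},M)$. Then there exists a unique vector field $\overset{*}{u}{}^{c}\in\Gamma(TE^*,\tau_{E^*},E^* )$ (the complete $(\overset{*}{g},h)$-lift of $\overset{*}{u}$) satisfying: (i) $\overset{*}{u}{}^{c}$ is $(h\circ\overset{*}{\pi})$-related with $\Gamma(Th\circ\rho,h\circ\eta)(\Gamma(\overset{*}{g},h)\overset{*}{u})$, i.e. $T(h\circ\overset{*}{\pi})(\overset{*}{u}{}^{c}_{\overset{*}{v}_x})=\{\Gamma(Th\circ\rho,h\circ\eta)(\Gamma(\overset{*}{g},h)\overset{*}{u})\}(h\circ\overset{*}{\pi}(\overset{*}{v}_x))$ for all $\overset{*}{v}_x\in E^*$; (ii) $\overset{*}{u}{}^{c}(\widehat{\overset{*}{\omega}})=\widehat{(\overset{*}{g},h)\mathcal L_{\overset{*}{u}}\overset{*}{\omega}}$ for every $\overset{*}{\omega}\in\Lambda^1(E^*,\overset{*}{\pi},M)$.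
   Context: All objects are smooth; $\mathcal F(M)=C^\infty(M)$; $\Gamma(E,\pi,M)$ denotes the sections of $(E,\pi,M)$; repeated indices are summed. Generalized Lie algebroid: $M,N$ are $m$-dimensional manifolds, $h:M\to N$ and $\eta:N\to M$ are diffeomorphisms, $(F,\nu,N)$ is a vector bundle, $(\rho,\eta)$ is a vector bundle morphism from $(F,\nu,N)$ to $(TM,\tau_M,M)$ ($\rho$ covers $\eta$), and $[\cdot,\cdot]_{F,h}$ is a Lie bracket on $\Gamma(F,\nu,N)$ with $[z,f w]_{F,h}=f[z,w]_{F,h}+\big(\Gamma(Th\circ\rho,h\circ\eta)(z)f\big)w$ for $f\in\mathcal F(N)$. Here, for a local frame $(t_\alpha)$ of $F$, local coordinates $(x^i)$ on $M$, and $\rho_\alpha^i$ the local component functions of $\rho$ (functions on $N$), $\Gamma(Th\circ\rho,h\circ\eta)(z)$ is the vector field on $N$ acting on $f\in\mathcal F(N)$ by $\Gamma(Th\circ\rho,h\circ\eta)(z^\alpha t_\alpha)(f)=z^\alpha\rho^i_\alpha\,\big(\tfrac{\partial(f\circ h)}{\partial x^i}\circ h^{-1}\big)$ (understood to be globally well defined); $z\mapsto\Gamma(Th\circ\rho,h\circ\eta)(z)$ is a Lie algebra morphism to vector fields on $N$. $E$ has rank $r$, local frame $(s_a)$; $E^*$ has dual frame $(s^a)$ and fibre coordinates $p_a$. $(\overset{*}{g},h)$ is a vector bundle morphism $E^*\to F$ covering $h$ with components $g^{\alpha b}$ (local functions on $M$), locally invertible: on each chart there are functions $\tilde g_{b\alpha}$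 with $\tilde g_{b\alpha}g^{\alpha a}=\delta^a_b$ and $g^{\alpha a}\tilde g_{a\beta}=\delta^\alpha_\beta$. $\Gamma(\overset{*}{g},h)(u_as^a)=((g^{\alpha a}u_a)\circ h^{-1})t_\alpha$, with inverse $\Gamma(\overset{*}{g}{}^{-1},h^{-1})(z^\alpha t_\alpha)=\tilde g_{b\alpha}(z^\alpha\circ h)s^b$. $\Lambda^1(E^*,\overset{*}{\pi},M)$ is the module of $\mathcal F(M)$-linear maps $\Gamma(E^*,\overset{*}{\pi},M)\to\mathcal F(M)$. The covariant Lie derivative of $\overset{*}{\omega}$ with respect to $\overset{*}{u}$ is $$((\overset{*}{g},h)\mathcal L_{\overset{*}{u}}\overset{*}{\omega})(\overset{*}{v})=\{\Gamma(Th\circ\rho,h\circ\eta)(\Gamma(\overset{*}{g},h)\overset{*}{u})(\overset{*}{\omega}(\overset{*}{v})\circ h^{-1})\}\circ h-\overset{*}{\omega}\big(\Gamma(\overset{*}{g}{}^{-1},h^{-1})[\Gamma(\overset{*}{g},h)\overset{*}{u},\Gamma(\overset{*}{g},h)\overset{*}{v}]_{F,h}\big).$$ For $\overset{*}{\omega}=\omega^as_a$, $\widehat{\overset{*}{\omega}}\in\mathcal F(E^* )$ is locally $p_a(\omega^a\circ\overset{*}{\pi})$. *)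

(* Defs.v *)
From HB Require Import structures.
From mathcomp Require Import all_boot all_order all_algebra.
From mathcomp Require Import all_classical all_reals all_analysis.
Set Implicit Arguments.
Unset Strict Implicit.
Unset Printing Implicit Defensive.
Import Order.TTheory GRing.Theory Num.Theory.
Import numFieldNormedType.Exports.
Local Open Scope classical_set_scope.
Local Open Scope ring_scope.

Section SmoothEuclidean.
Context {R : realType} {n : nat}.

(* U is meant to be open. *)
Fixpoint Ck (k : nat) (U : set 'rV[R]_n) (f : 'rV[R]_n -> R) : Prop :=
  if k is k'.+1 then
    (forall y, U y -> differentiable f y) /\
    (forall i : 'I_n, Ck k' U (fun y => 'D_(delta_mx 0 i) f y))
  else forall y, U y -> {for y, continuous f}.

Definition Cinfty (U : set 'rV[R]_n) (f : 'rV[R]_n -> R) : Prop :=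
  forall k, Ck k U f.

End SmoothEuclidean.

Section Manifolds.
Context {R : realType}.

Record chart (T : Type) (n : nat) := Chart {
  cdom : set T;
  cimg : set 'rV[R]_n;
  cmap : T -> 'rV[R]_n;
  cinv : 'rV[R]_n -> T }.

HB.instance Definition _ (T : Type) n := gen_eqMixin (chart T n).
HB.instance Definition _ (T : Type) n := gen_choiceMixin (chart T n).

(* f reads as a smooth map in the charts c (source) and c' (target).  Openness
   of the domain of the local expression expresses the continuity of f. *)
Definition smooth_in T T' n n' (c : chart T n) (c' : chart T' n')
    (f : T -> T') : Prop :=
  let W := cimg c `&` [set y | cdom c' (f (cinv c y))] in
  open W /\ forall j : 'I_n', Cinfty W (fun y => cmap c' (f (cinv c y)) 0 j).

Definition compat T n (c c' : chart T n) : Prop := smooth_in c c' id.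

Definition is_chart T n (c : chart T n) : Prop :=
  [/\ open (cimg c),
      forall x, cdom c x -> cimg c (cmap c x) /\ cinv c (cmap c x) = x &
      forall y, cimg c y -> cdom c (cinv c y) /\ cmap c (cinv c y) = y].

(* A set with a family of charts; it is a manifold when is_manifold holds. *)
Record premanifold (n : nat) := Premanifold {
  pts :> Type;
  charts : set (chart pts n) }.
Arguments charts {n} M : rename.

(* The topology is the one determined by the atlas. *)
Definition mopen n (M : premanifold n) (A : set M) : Prop :=
  forall c, charts M c -> open (cimg c `&` [set y | A (cinv c y)]).

Record is_manifold n (M : premanifold n) : Prop := IsManifold {
  mf_chart : forall c, charts M c -> is_chart c;
  mf_compat : forall c c', charts M c -> charts M c' -> compat c c';
  mf_cover : forall x : M, exists c, charts M c /\ cdom c x;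
  mf_hausdorff : forall x y : M, x <> y -> exists A B : set M,
    [/\ mopen A, mopen B, A x, B y & A `&` B = set0];
  mf_second_countable : exists B : nat -> set M, (forall k, mopen (B k)) /\
    forall (A : set M) x, mopen A -> A x -> exists k, B k x /\ B k `<=` A }.

(* Charts of the maximal atlas. *)
Definition local_coordinates n (M : premanifold n) (c : chart M n) : Prop :=
  is_chart c /\ forall c', charts M c' -> compat c c' /\ compat c' c.

(* Smoothness on an open subset D. *)
Definition smooth_on n (M : premanifold n) (D : set M) (f : M -> R) : Prop :=
  forall c, charts M c ->
    Cinfty (cimg c `&` [set y | D (cinv c y)]) (fun y => f (cinv c y)).

Definition smooth_fun n (M : premanifold n) (f : M -> R) : Prop :=
  smooth_on setT f.

Definition smooth_map n n' (M : premanifold n) (N : premanifold n')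
    (f : M -> N) : Prop :=
  forall c c', charts M c -> charts N c' -> smooth_in c c' f.

Record diffeo n (M N : premanifold n) := Diffeo {
  dfun :> M -> N;
  dinv : N -> M;
  dfunK : cancel dfun dinv;
  dinvK : cancel dinv dfun;
  dfun_smooth : smooth_map dfun;
  dinv_smooth : smooth_map dinv }.

(* A chosen chart of the atlas around x; the default value is not used on a
   manifold. *)
Definition chart_at n (M : premanifold n) (x : M) : chart M n :=
  xget (Chart set0 set0 (fun _ => 0) (fun _ => x))
    [set c | charts M c /\ cdom c x].

Record frame (T : Type) (V : T -> vectType R) (r : nat) := Frame {
  fdom : set T;
  fvec : forall x, 'I_r -> V x }.

HB.instance Definition _ T (V : T -> vectType R) r := gen_eqMixin (frame V r).
HB.instance Definition _ T (V : T -> vectType R) r :=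
  gen_choiceMixin (frame V r).

Definition ftuple T (V : T -> vectType R) r (s : frame V r) (x : T) :
    r.-tuple (V x) := [tuple fvec s x a | a < r].

Definition fcoord T (V : T -> vectType R) r (s : frame V r) (x : T)
    (v : V x) (a : 'I_r) : R := coord (ftuple s x) a v.

(* A vector bundle is given by its fibres and a family of local frames (i.e. of
   local trivializations); the axioms are in is_vbundle. *)
Record vbundle n (M : premanifold n) (r : nat) := VBundle {
  fib :> M -> vectType R;
  frames : set (frame fib r) }.
Arguments frames {n M r} E : rename.

Record is_vbundle n (M : premanifold n) r (E : vbundle M r) : Prop :=
  IsVBundle {
  vb_open : forall s, frames E s -> mopen (fdom s);
  vb_basis : forall s x, frames E s -> fdom s x ->
    basis_of fullv (ftuple s x);
  vb_cover : forall x : M, exists s, frames E s /\ fdom s x;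
  vb_compat : forall s s', frames E s -> frames E s' -> forall a b,
    smooth_on (fdom s `&` fdom s') (fun x => fcoord s (fvec s' x b) a) }.

Definition frame_at n (M : premanifold n) r (E : vbundle M r) (x : M) :
    frame E r :=
  xget (Frame set0 (fun _ _ => 0)) [set s | frames E s /\ fdom s x].

Definition sec n (M : premanifold n) r (E : vbundle M r) : Type :=
  forall x : M, E x.

Definition smooth_sec n (M : premanifold n) r (E : vbundle M r)
    (z : sec E) : Prop :=
  forall s, frames E s -> forall a,
    smooth_on (fdom s) (fun x => fcoord s (z x) a).

Definition dual_frame n (M : premanifold n) r (E : vbundle M r)
    (s : frame E r) : frame (fun x => 'Hom(E x, R^o) : vectType R) r :=
  Frame (V := fun x => 'Hom(E x, R^o) : vectType R) (fdom s)
    (fun x a => linfun (fun v : E x => fcoord s v a : R^o)).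

Definition dual n (M : premanifold n) r (E : vbundle M r) : vbundle M r :=
  VBundle [set dual_frame s | s in frames E].

(* The chart (x^i, p_a) of the total space induced by a chart of the base and a
   local frame. *)
Definition tot_chart n (M : premanifold n) r (E : vbundle M r)
    (c : chart M n) (s : frame E r) : chart {x : M & E x} (n + r) :=
  Chart
    [set v | cdom c (projT1 v) /\ fdom s (projT1 v)]
    [set y | cimg c (lsubmx y) /\ fdom s (cinv c (lsubmx y))]
    (fun v => row_mx (cmap c (projT1 v))
                     (\row_a fcoord s (projT2 v) a))
    (fun y => existT (fun x : M => E x) (cinv c (lsubmx y))
       (\sum_a rsubmx y 0 a *: fvec s (cinv c (lsubmx y)) a)).

Definition tot n (M : premanifold n) r (E : vbundle M r) :
    premanifold (n + r) :=
  Premanifold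
    [set tot_chart cs.1 cs.2 | cs in charts M `*` frames E].

Definition bproj n (M : premanifold n) r (E : vbundle M r) (v : tot E) : M :=
  projT1 v.

(* The tangent space at x is R^n, a tangent vector being represented by its
   components in the chart chart_at x.  The vector d/dx^i of another chart c
   is therefore the i-th column of the Jacobian of chart_at x with respect to
   c. *)
Definition coord_frame n (M : premanifold n) (c : chart M n) :
    frame (fun _ : M => 'rV[R]_n : vectType R) n :=
  Frame (V := fun _ : M => 'rV[R]_n : vectType R) (cdom c)
    (fun x i => 'd (cmap (chart_at x) \o cinv c) (cmap c x) (delta_mx 0 i)).

Definition tangent n (M : premanifold n) : vbundle M n :=
  VBundle [set coord_frame c | c in charts M].

Definition tmap n n' (M : premanifold n) (N : premanifold n') (f : M -> N)
    (x : M) (v : tangent M x) : tangent N (f x) :=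
  'd (cmap (chart_at (f x)) \o f \o cinv (chart_at x))
     (cmap (chart_at x) x) v.

(* The function X(f). *)
Definition act n (M : premanifold n) (X : sec (tangent M)) (f : M -> R)
    (x : M) : R :=
  'd (f \o cinv (chart_at x)) (cmap (chart_at x) x) (X x).

Definition mcomp n n' (M : premanifold n) (N : premanifold n') r p
    (E : vbundle M r) (F : vbundle N p) (f : M -> N)
    (phi : forall x, 'Hom(E x, F (f x))) (s : frame E r) (t : frame F p)
    (x : M) : 'M[R]_(p, r) :=
  \matrix_(alpha, b) fcoord t (phi x (fvec s x b)) alpha.

(* Vector bundle morphisms E -> F covering f. *)
Record vbmorph n n' (M : premanifold n) (N : premanifold n') r p
    (E : vbundle M r) (F : vbundle N p) (f : M -> N) := VBMorph {
  fibmap :> forall x, 'Hom(E x, F (f x));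
  fibmap_smooth : forall s t, frames E s -> frames F t ->
    forall alpha b, smooth_on (fdom s `&` [set x | fdom t (f x)])
      (fun x => mcomp fibmap s t x alpha b) }.

Definition locally_invertible n n' (M : premanifold n) (N : premanifold n')
    r p (E : vbundle M r) (F : vbundle N p) (f : M -> N)
    (g : vbmorph E F f) : Prop :=
  forall s t, frames E s -> frames F t ->
    let W := fdom s `&` [set x | fdom t (f x)] in
    exists gt : M -> 'M[R]_(r, p),
      (forall b alpha, smooth_on W (fun x => gt x b alpha)) /\
      (forall x, W x -> gt x *m mcomp g s t x = 1%:M /\
                        mcomp g s t x *m gt x = 1%:M).

(* The section y |-> g (u (h^-1 y)); the cast is along h (h^-1 y) = y. *)
Definition push_sec n (M N : premanifold n) r p (E : vbundle M r)
    (F : vbundle N p) (h : diffeo M N) (g : vbmorph E F h) (u : sec E) :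
    sec F :=
  fun y => eq_rect _ (fun y' : N => F y' : Type)
             (g (dinv h y) (u (dinv h y))) y (dinvK h y).

(* For invertible g_x, the map (g x)^-1 of the library has in local frames the
   components given by the inverse matrix. *)
Definition pull_sec n (M N : premanifold n) r p (E : vbundle M r)
    (F : vbundle N p) (h : diffeo M N) (g : vbmorph E F h) (z : sec F) :
    sec E :=
  fun x => ((g x)^-1)%VF (z (h x)).

(* Brackets and anchors are only meaningful on smooth sections, and all the
   axioms are relative to these. *)
Record gla n (M N : premanifold n) (h : diffeo M N) (eta : diffeo N M) p
    (F : vbundle N p) := GLA {
  gla_rho : vbmorph F (tangent M) eta;
  bracket : sec F -> sec F -> sec F;
  (* anchor z is Gamma(Th o rho, h o eta)(z), see anchorE. *)
  anchor : sec F -> sec (tangent N);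
  bracket_smooth : forall z w, smooth_sec z -> smooth_sec w ->
    smooth_sec (bracket z w);
  bracket_linear : forall (k : R) z z' w,
    smooth_sec z -> smooth_sec z' -> smooth_sec w ->
    bracket (fun y => k *: z y + z' y) w
    = fun y => k *: bracket z w y + bracket z' w y;
  bracket_antisym : forall z w, smooth_sec z -> smooth_sec w ->
    bracket z w = fun y => - bracket w z y;
  bracket_jacobi : forall z w v,
    smooth_sec z -> smooth_sec w -> smooth_sec v -> forall y,
    bracket z (bracket w v) y + bracket w (bracket v z) y
      + bracket v (bracket z w) y = 0;
  bracket_leibniz : forall z w (f : N -> R),
    smooth_sec z -> smooth_sec w -> smooth_fun f ->
    bracket z (fun y => f y *: w y)
    = fun y => f y *: bracket z w y + act (anchor z) f y *: w y;
  anchor_smooth : forall z, smooth_sec z -> smooth_sec (anchor z);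
  (* z^alpha rho^i_alpha (d(f o h)/dx^i o h^-1).  At y, rho^i_alpha is a
     component of a tangent vector at eta y while the derivative is taken at
     h^-1 y, so the coordinates (x^i) are required to be defined at both
     points. *)
  anchorE : forall z (f : N -> R) (c : chart M n) (t : frame F p) (y : N),
    smooth_sec z -> smooth_fun f -> local_coordinates c -> frames F t ->
    fdom t y -> cdom c (eta y) -> cdom c (dinv h y) ->
    act (anchor z) f y
    = \sum_(alpha < p) \sum_(i < n)
        fcoord t (z y) alpha
        * mcomp gla_rho t (coord_frame c) y i alpha
        * 'D_(delta_mx 0 i) (f \o h \o cinv c) (cmap c (dinv h y));
  anchor_linear : forall (k : R) z z', smooth_sec z -> smooth_sec z' ->
    anchor (fun y => k *: z y + z' y)
    = fun y => k *: anchor z y + anchor z' y;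
  anchor_bracket : forall z w (f : N -> R),
    smooth_sec z -> smooth_sec w -> smooth_fun f -> forall y,
    act (anchor (bracket z w)) f y
    = act (anchor z) (act (anchor w) f) y
      - act (anchor w) (act (anchor z) f) y }.

(* F(M)-linear maps from the smooth sections of E to F(M). *)
Record Lambda1 n (M : premanifold n) r (E : vbundle M r)
    (omega : sec E -> M -> R) : Prop := IsLambda1 {
  Lambda1_smooth : forall v, smooth_sec v -> smooth_fun (omega v);
  Lambda1_add : forall v w, smooth_sec v -> smooth_sec w ->
    omega (fun x => v x + w x) = fun x => omega v x + omega w x;
  Lambda1_scale : forall (f : M -> R) v, smooth_fun f -> smooth_sec v ->
    omega (fun x => f x *: v x) = fun x => f x * omega v x }.

(* The components omega^a(x) of omega in a local frame s around x, i.e.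
   omega(v)(x) = omega^a(x) v_a(x) where v_a are the components of v. *)
Definition Lambda1_comp n (M : premanifold n) r (E : vbundle M r)
    (omega : sec E -> M -> R) (s : frame E r) (x : M) : 'rV[R]_r :=
  xget 0 [set w : 'rV[R]_r | forall v : sec E, smooth_sec v ->
                 omega v x = \sum_a w 0 a * fcoord s (v x) a].

(* p_a (omega^a o pi) *)
Definition hat n (M : premanifold n) r (E : vbundle M r)
    (omega : sec E -> M -> R) (v : tot E) : R :=
  let s := frame_at E (bproj v) in
  \sum_a fcoord s (projT2 v) a * Lambda1_comp omega s (bproj v) 0 a.

Definition lie_derivative n (M N : premanifold n) (h : diffeo M N)
    (eta : diffeo N M) r p (E : vbundle M r) (F : vbundle N p)
    (A : gla h eta F) (g : vbmorph E F h) (u : sec E)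
    (omega : sec E -> M -> R) : sec E -> M -> R :=
  fun v x =>
    act (anchor A (push_sec g u)) (fun y => omega v (dinv h y)) (h x)
    - omega (pull_sec g (bracket A (push_sec g u) (push_sec g v))) x.

End Manifolds.

Arguments premanifold : clear implicits.

(* Main.v *)
Require Import Defs.
From mathcomp Require Import all_boot all_order all_algebra.
From mathcomp Require Import all_classical all_reals all_analysis.
From mathcomp Require Import ring.
Set Implicit Arguments.
Unset Strict Implicit.
Unset Printing Implicit Defensive.
Import Order.TTheory GRing.Theory Num.Theory.
Import numFieldNormedType.Exports.
Local Open Scope classical_set_scope.
Local Open Scope ring_scope.

(** Write [z] for the section of [F] pushed forward from [u], and let [X] be
    the vector field on [M] that corresponds through [h] to the anchor of [z],
    so that [X f] is [anchor z (f o h^-1) o h].  On sections of the dual bundle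
    [V] put [B v = pull [z, push v]].  The Leibniz rule of the bracket becomes
    [B (f v) = f B v + X(f) v]: the operator [B] is a derivation of the bundle
    [V] over [X], and the covariant Lie derivative of [omega] is
    [L omega = X (omega v) - omega (B v)].  The theorem is thus an instance of
    the correspondence between derivations of a vector bundle and linear
    vector fields on its total space, which is proved here for any [V], [X]
    and [B] ([lift_unique], [lift_exists], [lift_smooth]).  Relatedness of
    [uc] with the anchor says that [uc (f o pi) = X(f) o pi] for all locally
    smooth [f] on the base; in this form it prescribes the derivatives of some
    functions, as the condition on [hat omega] does ([is_liftP]).

    Uniqueness holds because the functions [f o pi] and [hat omega] separate
    the tangent vectors of the total space.  Among the first are the base
    coordinates; and a coframe member multiplied by a cutoff function is a
    one-form [theta] on global sections, whose [hat] is a fibre coordinate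
    near the given point.

    For existence this leaves one candidate at each point: its base
    components are those of [X], its fibre components the values of
    [hat (L theta)].  Near the point, [hat omega] is the sum of the products of
    the fibre coordinates with the components of [omega], so the condition on
    [hat omega] is the product rule.  Smoothness is then read off the same coordinates, since
    [hat] of a one-form is smooth and [L omega] is again a one-form: in
    [L omega (f v)] the two terms in [X(f)] cancel.

    One-forms act on global sections only, so everything local relies on
    cutoff functions ([smooth_bump]): they show that the value of
    [omega v] at a point depends on the value of [v] there alone, hence that
    [hat omega] at a vector is [omega] of any section through it ([hatE]).
    The cutoffs come from [exp (-1/t)] in a chart, extended by zero, which is
    smooth because compact sets are closed in a Hausdorff manifold. *)

(** * Smooth functions on open subsets of a Euclidean space *)

Section NearEq.
Context {K : numFieldType} {V W : normedModType K}.
Implicit Types f g : V -> W.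

Lemma near_eq_diff f g x : (\near x, f x = g x) -> differentiable f x ->
  differentiable g x /\ forall v, 'd g x v = 'd f x v.
Proof.
move=> fg df; have cdf := diff_continuous df.
have E : g \o shift x = cst (g x) + 'd f x +o_ 0 id.
  apply/eqaddoP => e e0; have /eqaddoP/(_ e e0) := diff_locally df.
  have fgx := nbhs_singleton fg.
  have : \forall h \near (0 : V), f (h + x) = g (h + x).
    move: fg; rewrite (near_shift 0 x) subr0.
    by apply: filterS => h /=; rewrite addrC.
  by apply: filterS2 => h /= E; rewrite !fctE /= E fgx.
have D : 'd g x = 'd f x :> (V -> W) by exact: diff_unique.
split; last by move=> v; rewrite D.
by apply/diff_locallyP; rewrite D.
Qed.

End NearEq.

Section CkTheory.
Context {R : realType}.

Lemma differentiable_rV (V : normedModType R) n (f : V -> 'rV[R]_n) x :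
  (forall j, differentiable (fun y => f y 0 j : R) x) -> differentiable f x.
Proof.
move=> df; have -> : f = \sum_(j < n) (fun y => f y 0 j *: delta_mx 0 j).
  by apply/funext => y; rewrite [LHS]row_sum_delta fct_sumE.
by apply: differentiable_sum => j; apply: differentiableZl.
Qed.

Section FixedDomain.
Context {n : nat}.
Implicit Types (f g : 'rV[R]_n -> R) (U O : set 'rV[R]_n).

Lemma Ck_cont k U f : Ck k U f -> forall y, U y -> {for y, continuous f}.
Proof.
by case: k => [//|k] [df _] y Uy; apply: differentiable_continuous; apply: df.
Qed.

Lemma CkW k U f : Ck k.+1 U f -> Ck k U f.
Proof.
elim: k f => [|k IH] f; first by move=> H y Uy; exact: Ck_cont H y Uy.
by move=> [df H]; split => // i; apply: IH.
Qed.

Lemma Ck_local k U f :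
  (forall y, U y -> exists O, O y /\ Ck k O f) -> Ck k U f.
Proof.
elim: k f => [|k IH] f H; first by move=> y Uy; have [W [Oy]] := H y Uy; apply.
split=> [y Uy|i]; first by have [W [Oy [df _]]] := H y Uy; exact: df.
by apply: IH => y Uy; have [W [Wy [_ HW]]] := H y Uy; exists W; split => //; exact: HW.
Qed.

Lemma Ck_sub k U O f : O `<=` U -> Ck k U f -> Ck k O f.
Proof. by move=> OU H; apply: Ck_local => y Oy; exists U; split => //; exact: OU. Qed.

Lemma open_near U y (P : 'rV[R]_n -> Prop) : open U -> U y ->
  (forall z, U z -> P z) -> \near y, P y.
Proof. by move=> oU Uy H; apply: filterS H _; exact: open_nbhs_nbhs. Qed.

Lemma Ck_eq k U f g : open U -> (forall y, U y -> f y = g y) ->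
  Ck k U f -> Ck k U g.
Proof.
move=> oU; elim: k f g => [|k IH] f g E H.
  move=> y Uy; have fg : \near y, f y = g y by exact: open_near E.
  rewrite /prop_for /continuous_at -(E y Uy); apply: cvg_trans (H y Uy).
  exact: (near_eq_cvg fg).
case: H => df H; split=> [y Uy|i].
  by apply: (near_eq_diff _ (df y Uy)).1; exact: open_near E.
by apply: IH (H i) => y Uy; apply: near_eq_derive; exact: open_near E.
Qed.

Lemma Ck_cst k U a : Ck k U (fun=> a).
Proof.
elim: k a => [|k IH] a; first by move=> y _; exact/differentiable_continuous/differentiable_cst.
split=> [y _|i]; first exact: differentiable_cst.
have -> : (fun y : 'rV[R]_n => 'D_(delta_mx 0 i) (fun=> a) y) = (fun=> 0).
  by apply/funext => y; exact: derive_cst.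
exact: IH.
Qed.

Lemma CkD k U f g : open U -> Ck k U f -> Ck k U g ->
  Ck k U (fun y => f y + g y).
Proof.
move=> oU; elim: k f g => [|k IH] f g Hf Hg.
  by move=> y Uy; apply: continuousD; [exact: Hf|exact: Hg].
case: Hf => df Hf; case: Hg => dg Hg; split=> [y Uy|i].
  by apply: differentiableD; [exact: df|exact: dg].
apply: Ck_eq (IH _ _ (Hf i) (Hg i)) => // y Uy.
by rewrite /= deriveD //; apply: diff_derivable; [exact: df|exact: dg].
Qed.

Lemma CkM k U f g : open U -> Ck k U f -> Ck k U g ->
  Ck k U (fun y => f y * g y).
Proof.
move=> oU; elim: k f g => [|k IH] f g Hf Hg.
  by move=> y Uy; apply: continuousM; [exact: Hf|exact: Hg].
have [df Hf1] := Hf; have [dg Hg1] := Hg; split=> [y Uy|i].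
  by apply: differentiableM; [exact: df|exact: dg].
apply: Ck_eq (CkD oU (IH _ _ (CkW Hf) (Hg1 i)) (IH _ _ (CkW Hg) (Hf1 i))) => //.
move=> y Uy /=; rewrite [RHS]deriveM //; apply: diff_derivable;
  [exact: df|exact: dg].
Qed.

Lemma CkV k U f : open U -> (forall y, U y -> f y != 0) -> Ck k U f ->
  Ck k U (fun y => (f y)^-1).
Proof.
move=> oU f0; elim: k => [|k IH] Hf.
  by move=> y Uy; apply: continuousV; [exact: f0|exact: Hf].
have [df Hf1] := Hf; split=> [y Uy|i].
  by apply: differentiableV; [exact: df|exact: f0].
have HV := IH (CkW Hf).
apply: Ck_eq (CkM oU (CkM oU (Ck_cst k U (-1)) (CkM oU HV HV)) (Hf1 i)) => //.
move=> y Uy /=; rewrite [RHS]deriveV; last 2 first.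
- exact: f0.
- by apply: diff_derivable; exact: df.
by rewrite mulN1r -invfM -expr2.
Qed.

Lemma Ck_sum k U (I : finType) (f : I -> 'rV[R]_n -> R) : open U ->
  (forall i, Ck k U (f i)) -> Ck k U (fun y => \sum_i f i y).
Proof.
move=> oU H; have -> : (fun y => \sum_i f i y) = \sum_i f i.
  by apply/funext => y; rewrite fct_sumE.
elim/big_ind : _ => [|g g' Hg Hg'|i _]; last exact: H.
  exact: Ck_cst.
exact: CkD.
Qed.

Lemma Ck_coord k U j : Ck k U (fun y => y 0 j).
Proof.
case: k => [|k].
  by move=> y _; apply: differentiable_continuous; exact: differentiable_coord.
split=> [y _|i]; first exact: differentiable_coord.
have -> : (fun y : 'rV[R]_n => 'D_(delta_mx 0 i) (fun y : 'rV[R]_n => y 0 j : R) y)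
    = (fun=> ((delta_mx 0 i : 'rV[R]_n) 0 j : R)).
  apply/funext => y; have dy := differentiable_coord y 0 j.
  have := derive_mx (t := y) (v := delta_mx 0 i) (@derivable_id _ _ _ _).
  by rewrite derive_id => /matrixP/(_ 0 j) ->; rewrite mxE.
exact: Ck_cst.
Qed.

End FixedDomain.

Lemma diff_partials n (f : 'rV[R]_n -> R) y w : differentiable f y ->
  'd f y w = \sum_(j < n) 'D_(delta_mx 0 j) f y * w 0 j.
Proof.
move=> df; rewrite {1}[w]row_sum_delta linear_sum; apply: eq_bigr => j _.
by rewrite linearZ /= deriveE // mulrC.
Qed.

Lemma differentiable_entry (V : normedModType R) n (f : V -> 'rV[R]_n) y j :
  differentiable f y -> differentiable (fun z => f z 0 j : R) y.
Proof.
by move=> df; exact: (differentiable_comp df (differentiable_coord (f y) 0 j)).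
Qed.

Lemma diff_row (V : normedModType R) n (f : V -> 'rV[R]_n) y v j :
  differentiable f y -> ('d f y v) 0 j = 'd (fun z => f z 0 j) y v.
Proof.
move=> df; rewrite -[RHS]deriveE; last exact: differentiable_entry.
by rewrite -deriveE // derive_mx ?mxE //; exact: diff_derivable.
Qed.

Lemma derive_comp n n' (phi : 'rV[R]_n -> 'rV[R]_n') (f : 'rV[R]_n' -> R) y v :
  differentiable phi y -> differentiable f (phi y) ->
  'D_v (f \o phi) y =
  \sum_(j < n') 'D_(delta_mx 0 j) f (phi y) * 'D_v (fun z => phi z 0 j) y.
Proof.
move=> dphi df; rewrite deriveE; last exact: differentiable_comp.
rewrite diff_comp // /= diff_partials //; apply: eq_bigr => j _.
congr (_ * _); rewrite diff_row // deriveE //; exact: differentiable_entry.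
Qed.

(** By the chain rule the partial derivatives of [f o phi] are sums of products
    of partial derivatives of [f], composed with [phi], and of the components
    of [phi].  The spare derivative of [phi] serves at order 0, where [phi] is
    continuous because its components are differentiable. *)
Lemma Ck_comp n n' k U O (phi : 'rV[R]_n -> 'rV[R]_n') (f : 'rV[R]_n' -> R) :
  open U -> open O -> (forall y, U y -> O (phi y)) ->
  (forall j, Ck k.+1 U (fun y => phi y 0 j)) -> Ck k O f -> Ck k U (f \o phi).
Proof.
move=> oU oO UO; elim: k f => [|k IH] f Hphi Hf.
  move=> y Uy; apply: continuous_comp; last by apply: Hf; exact: UO.
  by apply/differentiable_continuous/differentiable_rV => j; case: (Hphi j) => H _; exact: H.
have [df Hf1] := Hf.
have dphi y : U y -> differentiable phi y.
  by move=> Uy; apply/differentiable_rV => j; case: (Hphi j) => H _; exact: H.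
split=> [y Uy|i].
  by apply: differentiable_comp; [exact: dphi|apply: df; exact: UO].
pose g j y := ('D_(delta_mx 0 j) f \o phi) y * 'D_(delta_mx 0 i) (fun z => phi z 0 j) y.
have Hg : Ck k U (fun y => \sum_j g j y).
  apply: Ck_sum => // j; apply: CkM => //.
    by apply: IH (Hf1 j) => j'; apply: CkW.
  by case: (CkW (Hphi j)) => _; exact.
apply: Ck_eq Hg => // y Uy; rewrite /g /=; apply/esym; apply: derive_comp.
  exact: dphi.
by apply: df; exact: UO.
Qed.

Lemma Cinfty_local n (U : set 'rV[R]_n) f :
  (forall y, U y -> exists O, O y /\ Cinfty O f) -> Cinfty U f.
Proof.
by move=> H k; apply: Ck_local => y /H[W [Wy HW]]; exists W; split.
Qed.

Lemma Cinfty_sub n (U O : set 'rV[R]_n) f : O `<=` U -> Cinfty U f -> Cinfty O f.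
Proof. by move=> OU H k; exact: Ck_sub OU (H k). Qed.

Lemma Cinfty_eq n (U : set 'rV[R]_n) f g : open U -> (forall y, U y -> f y = g y) ->
  Cinfty U f -> Cinfty U g.
Proof. by move=> oU E H k; exact: Ck_eq (H k). Qed.

Lemma Cinfty_diff n (U : set 'rV[R]_n) f y :
  Cinfty U f -> U y -> differentiable f y.
Proof. by move=> /(_ 1%N)[df _]; exact: df. Qed.

Lemma Cinfty_comp n n' U O (phi : 'rV[R]_n -> 'rV[R]_n') (f : 'rV[R]_n' -> R) :
  open U -> open O -> (forall y, U y -> O (phi y)) ->
  (forall j, Cinfty U (fun y => phi y 0 j)) -> Cinfty O f ->
  Cinfty U (f \o phi).
Proof. by move=> oU oO UO Hp Hf k; apply: Ck_comp (Hf k) => // j; exact: Hp. Qed.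

Lemma Cinfty_derive n (U : set 'rV[R]_n) f i :
  Cinfty U f -> Cinfty U (fun y => 'D_(delta_mx 0 i) f y).
Proof. by move=> H k; case: (H k.+1) => _; exact. Qed.

End CkTheory.

(** * Flat functions and bumps on a Euclidean space *)

Section Flat.
Context {R : realType}.

(** The family [t^-k exp (-1/t)], extended by zero, is closed under
    differentiation up to linear combinations; hence every member is smooth,
    in particular [exp (-1/t)]. *)
Definition flat (k : nat) (t : R) : R :=
  if 0 < t then t^-1 ^+ k * expR (- t^-1) else 0.

(** With [s = 1/t], this is [s^(k+1) <= (k+1)! exp s], a term of the
    exponential series. *)
Lemma flat_bound k t : `|flat k t| <= k.+1`!%:R * `|t|.
Proof.
rewrite /flat; case: ifPn => [t0|_]; last by rewrite normr0 mulr_ge0.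
have s0 : 0 < t^-1 by rewrite invr_gt0.
rewrite (ger0_norm (ltW t0)) ger0_norm; last first.
  by rewrite mulr_ge0 ?expR_ge0 // exprn_ge0 // ltW.
rewrite expRN ler_pdivrMr ?expR_gt0 // -(ler_pM2l s0) -exprS mulrCA !mulrA.
rewrite mulfK ?gt_eqF // mulrC -ler_pdivrMr; last first.
  by rewrite ltr0n fact_gt0.
apply: le_trans (expR_ge1Dxn k (ltW s0)).
by rewrite lerDr.
Qed.

Lemma flat_cvg0 k : flat k h @[h --> 0] --> (0 : R).
Proof.
apply/cvgr0Pnorm_le => e e0.
have k0 : (0 : R) < k.+1`!%:R by rewrite ltr0n fact_gt0.
have : \forall h \near (0 : R), `|h| <= e / k.+1`!%:R.
  exists (e / k.+1`!%:R); rewrite /= ?divr_gt0 // => h.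
  by rewrite /ball_ /= sub0r normrN => /ltW.
apply: filterS => h H; apply: le_trans (flat_bound k h) _.
by rewrite mulrC -ler_pdivlMr.
Qed.

Lemma is_derive_flat k t :
  is_derive t (1 : R) (flat k) (flat k.+2 t - k%:R * flat k.+1 t).
Proof.
have [t0|t0|<-] := ltgtP 0 t.
- have E : \near t, t^-1 ^+ k * expR (- t^-1) = flat k t.
    by apply: filterS (lt_nbhsr t0) => x x0; rewrite /flat x0.
  apply: near_eq_is_derive E _.
  have tn0 : t != 0 by rewrite gt_eqF.
  have DV : is_derive t 1 (fun x : R => x^-1) (- t ^- 2 *: 1).
    exact: (is_deriveV tn0 (is_derive_id t 1)).
  have DN := is_deriveN DV.
  have De := @is_derive1_comp R expR (fun x => - x^-1) t _ _
    (is_derive_expR (- t^-1)) DN.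
  have DX := is_deriveX k DV.
  have -> : (fun x : R => x^-1 ^+ k * expR (- x^-1))
      = [eta GRing.inv] ^+ k * (expR \o (fun x : R => - x^-1)).
    by apply/funext => x; rewrite !fctE.
  apply: is_derive_eq (is_deriveM DX De) _.
  rewrite /flat t0 !fctE /= -exprVn.
  rewrite /GRing.scale /=.
  case: k {DX} => [|k]; rewrite /= ?exprS; ring.
- have E : \near t, (0 : R) = flat k t.
    by apply: filterS (lt_nbhsl t0) => x x0; rewrite /flat ifN // -leNgt ltW.
  apply: near_eq_is_derive E _.
  have t0' : (0 < t) = false by rewrite ltNge ltW.
  rewrite /flat t0' mulr0 subr0.
  exact: is_derive_cst.
have f0 j : flat j 0 = 0 by rewrite /flat ltxx.
rewrite !f0 mulr0 subr0.
have H : h^-1 *: (flat k (h *: 1 + 0) - flat k 0) @[h --> 0^'] --> (0 : R).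
  (* The difference quotient of [flat k] at 0 is [flat k.+1]. *)
  have fc : flat k.+1 h @[h --> 0^'] --> (0 : R).
    by move=> P /(@flat_cvg0 k.+1) /nbhs_dnbhs.
  apply: cvg_trans fc; apply: near_eq_cvg; near=> h.
  rewrite /flat ltxx subr0 addr0 [h *: 1]mulr1 exprS.
  by case: ifP => _; [rewrite -mulrA|rewrite [_ *: _]mulr0].
by apply: DeriveDef; [apply/cvg_ex; exists 0|apply/cvg_lim].
Unshelve. all: by end_near. Qed.

Lemma flat_ge0 t : 0 <= flat 0 t.
Proof. by rewrite /flat; case: ifP => // _; rewrite expr0 mul1r expR_ge0. Qed.

Lemma flat_gt0 t : 0 < t -> 0 < flat 0 t.
Proof. by move=> t0; rewrite /flat t0 expr0 mul1r expR_gt0. Qed.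

Lemma Ck_flat n j k (U : set 'rV[R]_n) f : open U ->
  Ck k U f -> Ck k U (fun y => flat j (f y)).
Proof.
move=> oU; have dflat i t : differentiable (flat i) t.
  by apply/derivable1_diffP; have [] := is_derive_flat i t.
elim: k j f => [|k IH] j f Hf.
  move=> y Uy; apply: (@continuous_comp _ _ _ f (flat j)); first exact: Hf.
  exact: differentiable_continuous.
have [df Hf1] := Hf; split=> [y Uy|i].
  by apply: (@differentiable_comp _ _ _ _ f (flat j)); first exact: df.
have H1 := IH j.+2 _ (CkW Hf); have H2 := IH j.+1 _ (CkW Hf).
have H := CkM oU (CkD oU H1 (CkM oU (Ck_cst k U (- j%:R)) H2)) (Hf1 i).
apply: Ck_eq H => // y Uy; rewrite deriveE; last exact: df.
rewrite deriveE; last first.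
  by apply: (@differentiable_comp _ _ _ _ f (flat j)); first exact: df.
rewrite (@diff_comp _ _ _ _ f (flat j)) //; last exact: df.
have [dr Dr] := is_derive_flat j (f y).
by rewrite /= deriv1E // derive1E Dr mulNr mulrC.
Qed.

(** A smooth step from 1 on [t <= 1] to 0 on [t >= 2]. *)
Definition plateau (t : R) : R := flat 0 (2 - t) / (flat 0 (2 - t) + flat 0 (t - 1)).

Lemma plateau_den t : 0 < flat 0 (2 - t) + flat 0 (t - 1).
Proof.
have [t2|t2] := ltP t 2.
  by rewrite ltr_wpDr ?flat_ge0 // flat_gt0 // subr_gt0.
rewrite ltr_wpDl ?flat_ge0 // flat_gt0 // subr_gt0.
by apply: lt_le_trans t2; rewrite ltr1n.
Qed.

Lemma plateau1 t : t <= 1 -> plateau t = 1.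
Proof.
move=> t1; have E : flat 0 (t - 1) = 0 by rewrite /flat ifN // -leNgt subr_le0.
by have := plateau_den t; rewrite /plateau E addr0 => H; rewrite divff ?gt_eqF.
Qed.

Lemma plateau0 t : 2 <= t -> plateau t = 0.
Proof.
by move=> t2; rewrite /plateau {1}/flat ifN ?mul0r // -leNgt subr_le0.
Qed.

Lemma Ck_plateau n k (U : set 'rV[R]_n) f : open U ->
  Ck k U f -> Ck k U (fun y => plateau (f y)).
Proof.
move=> oU Hf; have H1 : Ck k U (fun y => flat 0 (2 - f y)).
  apply: Ck_flat => //.
  apply: Ck_eq (CkD oU (Ck_cst k U 2) (CkM oU (Ck_cst k U (-1)) Hf)) => //.
  by move=> y _; rewrite mulN1r.
have H2 : Ck k U (fun y => flat 0 (f y - 1)).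
  by apply: Ck_flat => //; apply: CkD => //; exact: Ck_cst.
apply: CkM => //; apply: CkV => //; last exact: CkD.
by move=> y _; rewrite gt_eqF // plateau_den.
Qed.

Lemma bump_rV n (U : set 'rV[R]_n) y0 : open U -> U y0 ->
  exists f : 'rV[R]_n -> R, exists K W : set 'rV[R]_n,
  [/\ Cinfty setT f, compact K /\ K `<=` U, forall y, ~ K y -> f y = 0,
      open W /\ W y0 & forall y, W y -> f y = 1].
Proof.
move=> oU Uy0; have := open_nbhs_nbhs (conj oU Uy0).
rewrite -nbhs_ballE => -[e e0 eU].
pose d := e / 2; have d0 : 0 < d by rewrite divr_gt0.
have de : d < e by rewrite /d ltr_pdivrMr // mulr_natr mulr2n ltrDl.
(* Scaled so that a point with some coordinate further than [d] from that of
   [y0] has [s >= 2]. *)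
pose s (y : 'rV[R]_n) := 2 / d ^+ 2 * \sum_j (y 0 j - y0 0 j) * (y 0 j - y0 0 j).
have sC k : Ck k setT s.
  apply: CkM; [exact: openT|exact: Ck_cst|apply: Ck_sum; first exact: openT].
  move=> j; have H : Ck k setT (fun y : 'rV[R]_n => y 0 j - y0 0 j).
    by apply: CkD; [exact: openT|exact: Ck_coord|exact: Ck_cst].
  by apply: CkM => //; exact: openT.
exists (fun y => plateau (s y)).
exists [set y | forall j, y ord0 j \in `[y0 0 j - d, y0 0 j + d]].
exists (s @^-1` [set t | t < 1]).
split.
- by move=> k; apply: Ck_plateau => //; exact: openT.
- split.
    apply: (@rV_compact _ _ (fun j => `[y0 0 j - d, y0 0 j + d]%classic)).
    by move=> j; exact: segment_compact.
  move=> y Hy; apply: eU; split=> // i j; rewrite ord1.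
  rewrite /ball /= /ball_ /=; apply: le_lt_trans de.
  by have := Hy j; rewrite in_itv /= ler_distlC.
- move=> y /existsNP[j]; rewrite in_itv /= -ler_distlC distrC => /negP.
  rewrite -ltNge => dj.
  apply: plateau0; rewrite /s mulrAC ler_pdivlMr ?exprn_gt0 // ler_pM2l //.
  rewrite (bigD1 j) //= -expr2 -(real_normK (num_real (y 0 j - y0 0 j))).
  apply: ler_wpDr; first by apply: sumr_ge0 => i _; rewrite -expr2 sqr_ge0.
  by apply: lerXn2r; rewrite ?nnegrE //; exact: ltW.
- split.
    apply: open_comp; last exact: open_lt.
    by move=> y _; exact: (Ck_cont (sC 0%N)).
  rewrite /= /s big1 ?mulr0 // => j _; rewrite subrr mul0r //.
- by move=> y /= /ltW; exact: plateau1.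
Qed.

End Flat.

(** * Smooth functions and tangent vectors on a manifold *)

Section Atlas.
Context {R : realType}.

(** The part of the manifold axioms that calculus at a point needs.  It is kept
    apart because it is all that is established for the total space. *)
Record atlas n (M : premanifold R n) : Prop := Atlas {
  atlas_chart : forall c : @chart R M n, charts c -> is_chart c;
  atlas_compat : forall c c' : @chart R M n, charts c -> charts c' -> compat c c';
  atlas_cover : forall x : M, exists c : @chart R M n, charts c /\ cdom c x }.

Lemma manifold_atlas n (M : premanifold R n) : is_manifold M -> atlas M.
Proof. by case=> *; split. Qed.

Section Calculus.
Context {n : nat} {M : premanifold R n} (aM : atlas M).
Implicit Types (c : @chart R M n) (D O : set M) (f g : M -> R) (x : M).

Lemma chart_atP x : charts (chart_at x) /\ cdom (chart_at x) x.
Proof.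
rewrite /chart_at; case: xgetP => [c -> //|H].
by have [c hc] := atlas_cover aM x; case: (H c).
Qed.

Lemma chart_at_charts x : charts (chart_at x).
Proof. by case: (chart_atP x). Qed.

Lemma chart_at_cdom x : cdom (chart_at x) x.
Proof. by case: (chart_atP x). Qed.

Lemma cmap_cimg c x : charts c -> cdom c x -> cimg c (cmap c x).
Proof. by move=> /(atlas_chart aM)[_ H _] /H[]. Qed.

Lemma cmapK c x : charts c -> cdom c x -> cinv c (cmap c x) = x.
Proof. by move=> /(atlas_chart aM)[_ H _] /H[]. Qed.

Lemma cinv_cdom c y : charts c -> cimg c y -> cdom c (cinv c y).
Proof. by move=> /(atlas_chart aM)[_ _ H] /H[]. Qed.

Lemma cinvK c y : charts c -> cimg c y -> cmap c (cinv c y) = y.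
Proof. by move=> /(atlas_chart aM)[_ _ H] /H[]. Qed.

Lemma mopenT : mopen (setT : set M).
Proof. by move=> c /(atlas_chart aM)[oc _ _]; rewrite setIT. Qed.

Lemma mopenI D O : mopen D -> mopen O -> mopen (D `&` O).
Proof.
by move=> oD oO c hc; have := openI (oD c hc) (oO c hc); rewrite setIACA setIid.
Qed.

Lemma mopen_cdom c : charts c -> mopen (cdom c).
Proof. by move=> hc c' hc'; have [] := atlas_compat aM hc' hc. Qed.

Lemma smooth_on_local D f :
  (forall x, D x -> exists O, O x /\ smooth_on O f) -> smooth_on D f.
Proof.
move=> H c hc; apply: Cinfty_local => y [cy Dy]; have [W [Wy HW]] := H _ Dy.
by exists (cimg c `&` [set y | W (cinv c y)]); split; [split|exact: HW].
Qed.

Lemma smooth_on_sub D O f : O `<=` D -> smooth_on D f -> smooth_on O f.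
Proof. by move=> OD H; apply: smooth_on_local => x /OD Dx; exists D. Qed.

Lemma smooth_on_eq D f g : mopen D -> (forall x, D x -> f x = g x) ->
  smooth_on D f -> smooth_on D g.
Proof.
move=> oD E H c hc; apply: Cinfty_eq (H c hc); first exact: oD.
by move=> y [_ /E].
Qed.

Lemma smooth_on_cst D a : smooth_on D (fun=> a).
Proof. by move=> c hc k; exact: Ck_cst. Qed.

Lemma smooth_onD D f g : mopen D -> smooth_on D f -> smooth_on D g ->
  smooth_on D (fun x => f x + g x).
Proof.
by move=> oD Hf Hg c hc k; apply: CkD; [exact: oD|exact: Hf|exact: Hg].
Qed.

Lemma smooth_onM D f g : mopen D -> smooth_on D f -> smooth_on D g ->
  smooth_on D (fun x => f x * g x).
Proof.
by move=> oD Hf Hg c hc k; apply: CkM; [exact: oD|exact: Hf|exact: Hg].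
Qed.

Lemma smooth_onB D f g : mopen D -> smooth_on D f ->
  smooth_on D g -> smooth_on D (fun x => f x - g x).
Proof.
move=> oD sf sg.
apply: smooth_on_eq (smooth_onD oD sf (smooth_onM oD (smooth_on_cst D (-1)) sg)) => //.
by move=> x _; rewrite mulN1r.
Qed.

Lemma smooth_on_sum D (I : finType) (f : I -> M -> R) : mopen D ->
  (forall i, smooth_on D (f i)) -> smooth_on D (fun x => \sum_i f i x).
Proof.
by move=> oD H c hc k; apply: (Ck_sum (f := fun i y => f i (cinv c y)));
  [exact: oD|move=> i; exact: H].
Qed.

Lemma smooth_coord c j : charts c -> smooth_on (cdom c) (fun x => cmap c x 0 j).
Proof. by move=> hc c' hc'; have [_] := atlas_compat aM hc' hc. Qed.

(** Smoothness need only be checked in one chart, the transition maps being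
    smooth. *)
Lemma smooth_chart c D f : charts c -> mopen D -> D `<=` cdom c ->
  Cinfty (cimg c `&` [set y | D (cinv c y)]) (f \o cinv c) -> smooth_on D f.
Proof.
move=> hc oD Dc Hf c' hc'.
have H : Cinfty (cimg c' `&` [set y | D (cinv c' y)])
           ((f \o cinv c) \o (cmap c \o cinv c')).
  apply: Cinfty_comp Hf; [exact: oD|exact: oD| |].
  - move=> y [c'y Dy]; split; first by apply: cmap_cimg => //; exact: Dc.
    by rewrite /= cmapK //; exact: Dc.
  - move=> j; apply: Cinfty_sub (smooth_coord j hc hc') => y [c'y Dy].
    by split => //; exact: Dc.
apply: Cinfty_eq H; first exact: oD.
by move=> y [_ /Dc Dy]; rewrite /= cmapK.
Qed.

Definition smooth_at x f : Prop := exists O, [/\ mopen O, O x & smooth_on O f].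

Lemma smooth_on_at D x f : mopen D -> D x -> smooth_on D f -> smooth_at x f.
Proof. by move=> oD Dx H; exists D. Qed.

Lemma smooth_fun_at x f : smooth_fun f -> smooth_at x f.
Proof. by move=> H; exists setT; split => //; exact: mopenT. Qed.

Lemma smooth_at_diff x f c : charts c -> cdom c x -> smooth_at x f ->
  differentiable (f \o cinv c) (cmap c x).
Proof.
move=> hc cx [W [oW Wx H]]; apply: Cinfty_diff (H c hc) _.
by split; [exact: cmap_cimg|rewrite /= cmapK].
Qed.

Lemma mopen_near x c D : charts c -> cdom c x -> mopen D -> D x ->
  \forall y \near cmap c x, D (cinv c y).
Proof.
move=> hc cx oD Dx; apply: (open_near (oD c hc)); last by move=> y [].
by split; [exact: cmap_cimg|rewrite /= cmapK].
Qed.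

(** The derivative of [f] along the tangent vector [v] at [x].  Tangent vectors
    being stored by components in [chart_at x], they are handled below through
    this derivation, which does not refer to a chart. *)
Definition tderive x (v : 'rV[R]_n) f : R :=
  'd (f \o cinv (chart_at x)) (cmap (chart_at x) x) v.

Lemma actE (X : sec (tangent M)) f x : act X f x = tderive x (X x) f.
Proof. by []. Qed.

Let hx x := chart_at_charts x.
Let dx x := chart_at_cdom x.

Lemma tderive_eq D x v f g : mopen D -> D x -> (forall y, D y -> f y = g y) ->
  smooth_at x f -> tderive x v f = tderive x v g.
Proof.
move=> oD Dx E sf.
have [|_ D'] := @near_eq_diff _ _ _ (f \o cinv (chart_at x)) (g \o cinv (chart_at x))
  _ _ (smooth_at_diff (hx x) (dx x) sf).
  by apply: filterS (mopen_near (hx x) (dx x) oD Dx) => y /E.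
exact: esym (D' v).
Qed.

Lemma tderive_cst x v a : tderive x v (fun=> a) = 0.
Proof. exact: (congr1 (fun F => F v) (diff_cst a _)). Qed.

Lemma tderiveD x v f g : smooth_at x f -> smooth_at x g ->
  tderive x v (fun y => f y + g y) = tderive x v f + tderive x v g.
Proof.
move=> /(smooth_at_diff (hx x) (dx x)) df /(smooth_at_diff (hx x) (dx x)) dg.
exact: (congr1 (fun F => F v) (diffD df dg)).
Qed.

Lemma tderiveM x v f g : smooth_at x f -> smooth_at x g ->
  tderive x v (fun y => f y * g y) = f x * tderive x v g + g x * tderive x v f.
Proof.
move=> /(smooth_at_diff (hx x) (dx x)) df /(smooth_at_diff (hx x) (dx x)) dg.
have := congr1 (fun F => F v) (diffM df dg); by rewrite /= cmapK.
Qed.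

Lemma smooth_atD x f g : smooth_at x f -> smooth_at x g ->
  smooth_at x (fun y => f y + g y).
Proof.
move=> [W [oW Wx Hf]] [W' [oW' Wx' Hg]]; exists (W `&` W'); split => //.
  exact: mopenI.
by apply: smooth_onD; [exact: mopenI|apply: smooth_on_sub Hf => y []
  |apply: smooth_on_sub Hg => y []].
Qed.

Lemma smooth_atM x f g : smooth_at x f -> smooth_at x g ->
  smooth_at x (fun y => f y * g y).
Proof.
move=> [W [oW Wx Hf]] [W' [oW' Wx' Hg]]; exists (W `&` W'); split => //.
  exact: mopenI.
by apply: smooth_onM; [exact: mopenI|apply: smooth_on_sub Hf => y []
  |apply: smooth_on_sub Hg => y []].
Qed.

Lemma smooth_at_sum x (I : finType) (f : I -> M -> R) :
  (forall i, smooth_at x (f i)) -> smooth_at x (fun y => \sum_i f i y).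
Proof.
move=> H; have -> : (fun y => \sum_i f i y) = \sum_i f i.
  by apply/funext => y; rewrite fct_sumE.
elim/big_ind : _ => [|g g' Hg Hg'|i _]; last exact: H.
  by apply: smooth_fun_at; exact: smooth_on_cst.
exact: smooth_atD.
Qed.

Lemma tderive_sum x v (I : finType) (f : I -> M -> R) :
  (forall i, smooth_at x (f i)) ->
  tderive x v (fun y => \sum_i f i y) = \sum_i tderive x v (f i).
Proof.
move=> H; have -> : (fun y => \sum_i f i y) = \sum_i f i.
  by apply/funext => y; rewrite fct_sumE.
suff [] : smooth_at x (\sum_i f i) /\ tderive x v (\sum_i f i) = \sum_i tderive x v (f i) by [].
elim/big_ind2 : _ => [|g a g' a' [Hg <-] [Hg' <-]|i _]; last by split; first exact: H.
  by split; [apply: smooth_fun_at; exact: smooth_on_cst|exact: tderive_cst].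
by split; [exact: smooth_atD|exact: tderiveD].
Qed.

Lemma tderive_trans x v f c : charts c -> cdom c x -> smooth_at x f ->
  tderive x v f = 'd (f \o cinv c) (cmap c x) (\row_j tderive x v (fun y => cmap c y 0 j)).
Proof.
move=> hc cx sf; set c0 := chart_at x.
have dphi : differentiable (cmap c \o cinv c0) (cmap c0 x).
  apply: differentiable_rV => j; apply: (smooth_at_diff (f := fun y => cmap c y 0 j)).
  - exact: hx.
  - exact: dx.
  - exact: smooth_on_at (mopen_cdom hc) cx (smooth_coord j hc).
have E0 : (cmap c \o cinv c0) (cmap c0 x) = cmap c x by rewrite /= cmapK //; [exact: hx|exact: dx].
have df := smooth_at_diff hc cx sf; rewrite -E0 in df.
have [|_ D'] := @near_eq_diff _ _ _ ((f \o cinv c) \o (cmap c \o cinv c0)) (f \o cinv c0)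
  (cmap c0 x) _ (differentiable_comp dphi df).
  apply: filterS (mopen_near (hx x) (dx x) (mopen_cdom hc) cx) => y cy.
  by rewrite /= cmapK.
apply: etrans (D' v) _.
apply: etrans (congr1 (fun F => F v) (diff_comp dphi df)) _.
have E1 : 'd (cmap c \o cinv c0) (cmap c0 x) v = \row_j tderive x v (fun y => cmap c y 0 j).
  by apply/rowP => j; rewrite mxE; exact: diff_row.
by rewrite -E1 -E0.
Qed.

Lemma tderive_chart x v f c : charts c -> cdom c x -> smooth_at x f ->
  tderive x v f = \sum_j 'D_(delta_mx 0 j) (f \o cinv c) (cmap c x)
                    * tderive x v (fun y => cmap c y 0 j).
Proof.
move=> hc cx sf; rewrite (tderive_trans v hc cx sf) diff_partials.
  by apply: eq_bigr => j _; rewrite mxE.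
exact: smooth_at_diff.
Qed.

Lemma diff_cmap c z v j : charts c -> cimg c z ->
  'd ((fun y => cmap c y 0 j) \o cinv c) z v = v 0 j.
Proof.
move=> hc cz.
have [|_ D'] := @near_eq_diff _ _ _ (fun z : 'rV[R]_n => z 0 j : R)
    ((fun y => cmap c y 0 j) \o cinv c) z _ (differentiable_coord z 0 j).
  apply: (open_near (mopenT hc)); first by split.
  by move=> y [cy _]; rewrite /= cinvK.
apply: etrans (D' v) _.
have did : differentiable (@idfun 'rV[R]_n) z by exact: ex_diff.
apply: etrans (esym (diff_row v j did)) _.
by rewrite (congr1 (fun F => F v) (diff_val (is_diff_def := is_diff_id z))).
Qed.

Lemma tderive_coord_at x v j : tderive x v (fun y => cmap (chart_at x) y 0 j) = v 0 j.
Proof. by apply: diff_cmap; [exact: hx|apply: cmap_cimg; [exact: hx|exact: dx]]. Qed.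

(** The coordinates of [chart_at x] are smooth at [x] and recover the
    components. *)
Lemma tderive_inj x v w : (forall f, smooth_at x f -> tderive x v f = tderive x w f) -> v = w.
Proof.
move=> H; apply/rowP => j; rewrite -!(tderive_coord_at x); apply: H.
exact: smooth_on_at (mopen_cdom (hx x)) (dx x) (smooth_coord j (hx x)).
Qed.

Lemma tderive_lin x (I : finType) (k : I -> R) (e : I -> 'rV[R]_n) f :
  tderive x (\sum_i k i *: e i) f = \sum_i k i * tderive x (e i) f.
Proof. by rewrite /tderive linear_sum; apply: eq_bigr => i _; rewrite linearZ. Qed.

Lemma tderive_coord_frame x c f i : charts c -> cdom c x -> smooth_at x f ->
  tderive x (fvec (coord_frame c) x i) f = 'd (f \o cinv c) (cmap c x) (delta_mx 0 i).
Proof.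
move=> hc cx sf; rewrite /= ; set c0 := chart_at x.
have dphi : differentiable (cmap c0 \o cinv c) (cmap c x).
  apply: differentiable_rV => j; apply: (smooth_at_diff (f := fun y => cmap c0 y 0 j)) => //.
  exact: smooth_on_at (mopen_cdom (hx x)) (dx x) (smooth_coord j (hx x)).
have E0 : (cmap c0 \o cinv c) (cmap c x) = cmap c0 x by rewrite /= cmapK.
have df := smooth_at_diff (hx x) (dx x) sf; rewrite -/c0 -E0 in df.
have [|_ D'] := @near_eq_diff _ _ _ ((f \o cinv c0) \o (cmap c0 \o cinv c)) (f \o cinv c)
  (cmap c x) _ (differentiable_comp dphi df).
  apply: filterS (mopen_near hc cx (mopen_cdom (hx x)) (dx x)) => y cy.
  by rewrite /= cmapK //; exact: hx.
apply/esym; apply: etrans (D' _) _.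
apply: etrans (congr1 (fun F => F (delta_mx 0 i)) (diff_comp dphi df)) _.
by rewrite E0.
Qed.

(** The frame of a chart is dual to its coordinate functions, so components in
    it are derivatives of the coordinates. *)
Lemma fcoord_coord_frame c x v j : charts c -> cdom c x ->
  fcoord (x := x) (coord_frame c) v j = tderive x v (fun y => cmap c y 0 j).
Proof.
move=> hc cx; set e := fvec (coord_frame c) x.
have sc i : smooth_at x (fun y => cmap c y 0 i).
  exact: smooth_on_at (mopen_cdom hc) cx (smooth_coord i hc).
have de (k : 'I_n -> R) i : tderive x (\sum_i k i *: e i) (fun y => cmap c y 0 i) = k i.
  rewrite tderive_lin (bigD1 i) //= big1 ?addr0 => [|i' ni].
    by rewrite tderive_coord_frame // diff_cmap ?mxE ?eqxx ?mulr1 //; exact: cmap_cimg.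
  rewrite tderive_coord_frame // diff_cmap ?mxE //; last exact: cmap_cimg.
  by rewrite eq_sym (negbTE ni) andbF mulr0.
have E : v = \sum_i tderive x v (fun y => cmap c y 0 i) *: e i.
  apply: (@tderive_inj x) => f sf; rewrite !(tderive_chart _ hc cx sf).
  by apply: eq_bigr => i _; rewrite de.
have fr : free (ftuple (coord_frame c) x).
  apply/freeP => k k0 i; rewrite -(de k i).
  rewrite -(_ : \sum_i0 k i0 *: (ftuple (coord_frame c) x)`_i0 = \sum_i0 k i0 *: e i0).
    by rewrite k0 /tderive linear0.
  by apply: eq_bigr => i0 _; rewrite -tnth_nth tnth_mktuple.
rewrite /fcoord {1}E -(coord_sum_free (fun i => tderive x v (fun y => cmap c y 0 i)) j fr).
congr (coord _ _ _); apply: eq_bigr => i _; by rewrite -tnth_nth tnth_mktuple.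
Qed.

Lemma smooth_secT (X : sec (tangent M)) :
  smooth_sec X <->
  (forall c j, charts c -> smooth_on (cdom c) (fun x => tderive x (X x) (fun y => cmap c y 0 j))).
Proof.
split=> [sX c j hc|H _ [c hc <-] j].
  have H := sX (coord_frame c) (ex_intro2 _ _ c hc erefl) j.
  apply: smooth_on_eq H; first exact: mopen_cdom.
  by move=> x cx; exact: fcoord_coord_frame.
apply: smooth_on_eq (H c j hc); first exact: mopen_cdom.
by move=> x cx; apply/esym; exact: fcoord_coord_frame.
Qed.

(** In a chart [X f] is the sum of the partial derivatives of [f] weighted by
    the components of [X], see [tderive_chart]. *)
Lemma act_smooth (X : sec (tangent M)) D f : smooth_sec X ->
  mopen D -> smooth_on D f -> smooth_on D (act X f).
Proof.
move=> /smooth_secT sX oD sf; apply: smooth_on_local => x Dx.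
have [hc cx] := chart_atP x; set c := chart_at x in hc cx.
have oc := mopen_cdom hc; have oDc := mopenI oD oc.
exists (D `&` cdom c); split=> //.
have H j : smooth_on (D `&` cdom c) (fun y => 'D_(delta_mx 0 j) (f \o cinv c) (cmap c y)
    * tderive y (X y) (fun y => cmap c y 0 j)).
  apply: smooth_onM => //; last by apply: smooth_on_sub (sX c j hc) => y [].
  apply: (smooth_chart hc) => //.
  have sD := Cinfty_derive j (smooth_on_sub (fun y (H : (D `&` cdom c) y) => H.1) sf hc).
  apply: Cinfty_eq sD; first exact: oDc.
  by move=> y [cy _]; rewrite /= cinvK.
apply: smooth_on_eq (smooth_on_sum oDc H) => // y [Dy cy].
by rewrite -(tderive_chart _ hc cy) //; exact: smooth_on_at oD Dy sf.
Qed.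

End Calculus.

Section Maps.
Context {n n' : nat} {M : premanifold R n} {N : premanifold R n'}.
Context (aM : atlas M) (aN : atlas N) (f : M -> N) (sf : smooth_map f).

Lemma mopen_preimage (D : set N) : mopen D -> mopen (f @^-1` D).
Proof.
move=> oD c hc; rewrite openE => y [cy Dy].
have [c' [hc' c'y]] := atlas_cover aN (f (cinv c y)).
have [oW sW] := sf hc hc'.
pose W := cimg c `&` [set y | cdom c' (f (cinv c y))].
have Wy : W y by [].
have cphi : {for y, continuous (cmap c' \o f \o cinv c)}.
  apply/differentiable_continuous/differentiable_rV => j.
  exact: Cinfty_diff (sW j) Wy.
have V : nbhs (cmap c' (f (cinv c y))) (cimg c' `&` [set y | D (cinv c' y)]).
  apply: open_nbhs_nbhs; split; first exact: oD.
  by split; [exact: cmap_cimg|rewrite /= cmapK].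
apply: filterS2 (open_nbhs_nbhs (conj oW Wy)) (cphi _ V) => z [cz c'z] [_ /=].
by rewrite cmapK.
Qed.

Lemma smooth_on_comp (D : set N) (k : N -> R) : mopen D -> smooth_on D k ->
  smooth_on (f @^-1` D) (k \o f).
Proof.
move=> oD sk; have oP := mopen_preimage oD.
apply: smooth_on_local => x Dx; have [c' [hc' c'x]] := atlas_cover aN (f x).
pose W := f @^-1` (D `&` cdom c').
have oW : mopen W by apply: mopen_preimage; exact: mopenI (mopen_cdom aN hc').
exists W; split=> [|c hc]; first by split.
have H : Cinfty (cimg c `&` [set y | W (cinv c y)])
           ((k \o cinv c') \o (cmap c' \o f \o cinv c)).
  apply: Cinfty_comp (sk c' hc'); [exact: oW|exact: oD| |].
  - move=> y [cy [Dy c'y]]; split; first exact: cmap_cimg.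
    by rewrite /= cmapK.
  - have [_ sW] := sf hc hc'.
    by move=> j; apply: Cinfty_sub (sW j) => y [cy [_ c'y]]; split.
apply: Cinfty_eq H; first exact: oW.
by move=> y [_ [_ c'y]]; rewrite /= cmapK.
Qed.

Lemma smooth_fun_comp (k : N -> R) : smooth_fun k -> smooth_fun (k \o f).
Proof. by move=> sk; exact: (smooth_on_comp (mopenT aN) sk). Qed.

Lemma smooth_at_comp x (k : N -> R) : smooth_at (f x) k -> smooth_at x (k \o f).
Proof.
move=> [W [oW Wx H]]; exists (f @^-1` W); split=> //; first exact: mopen_preimage.
exact: smooth_on_comp.
Qed.

Lemma tderive_tmap x (v : 'rV[R]_n) (k : N -> R) : smooth_at (f x) k ->
  tderive (f x) (tmap f (v : tangent M x)) k = tderive x v (k \o f).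
Proof.
move=> sk; rewrite /tmap /tderive; set c0 := chart_at x; set c' := chart_at (f x).
have [hc cx] := chart_atP aM x; have [hc' c'x] := chart_atP aN (f x).
have sc j : smooth_at (f x) (fun y => cmap c' y 0 j).
  exact: smooth_on_at (mopen_cdom aN hc') c'x (smooth_coord aN j hc').
have dphi : differentiable (cmap c' \o f \o cinv c0) (cmap c0 x).
  apply: differentiable_rV => j.
  exact: (smooth_at_diff aM hc cx (smooth_at_comp (sc j))).
have E0 : (cmap c' \o f \o cinv c0) (cmap c0 x) = cmap c' (f x).
  by rewrite /= (cmapK aM).
have dk := smooth_at_diff aN hc' c'x sk; rewrite -/c' -E0 in dk.
have [|_ D'] := @near_eq_diff _ _ _ ((k \o cinv c') \o (cmap c' \o f \o cinv c0))
  (k \o f \o cinv c0) (cmap c0 x) _ (differentiable_comp dphi dk).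
  have oW := mopen_preimage (mopen_cdom aN hc').
  apply: filterS (mopen_near aM hc cx oW c'x) => y cy.
  by rewrite /= (cmapK aN).
apply/esym; apply: etrans (D' v) _.
apply: etrans (congr1 (fun F => F v) (diff_comp dphi dk)) _.
by rewrite E0.
Qed.

End Maps.

Lemma smooth_map_coord n n' (M : premanifold R n) (N : premanifold R n')
    (f : M -> N) :
  (forall c : @chart R N n', charts c -> mopen (f @^-1` cdom c) /\
     forall j, smooth_on (f @^-1` cdom c) (fun x => cmap c (f x) 0 j)) ->
  smooth_map f.
Proof.
move=> H c c' hc hc'; have [oW sW] := H c' hc'; split; first exact: oW.
by move=> j; exact: (sW j c hc).
Qed.

End Atlas.

(** * Cutoff functions on a manifold *)

Section Bump.
Context {R : realType} {n : nat} {M : premanifold R n} (mM : is_manifold M).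

Let aM := manifold_atlas mM.

(** For each [k] in [K], Hausdorff separation excludes [cinv c k] from a
    neighbourhood of a point outside the image, uniformly near [k]; compactness
    of [K] makes the neighbourhood uniform on [K]. *)
Lemma compact_image_closed (c : @chart R M n) (K : set 'rV[R]_n) :
  charts c -> K `<=` cimg c -> compact K -> mopen (~` (cinv c @` K)).
Proof.
move=> hc Kc /compact_near_coveringP cK c' hc'; rewrite openE => y [c'y yK].
have H : \forall z \near y, K `<=` (fun k => cinv c k <> cinv c' z).
  apply: (cK _ (nbhs y) (fun z k => cinv c k <> cinv c' z)) => k Kk.
  have ne : cinv c k <> cinv c' y by move=> E; apply: yK; exists k.
  have [A [B [oA oB Ak By AB]]] := mf_hausdorff mM ne.
  have nA : nbhs k (cimg c `&` [set z | A (cinv c z)]).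
    by apply: open_nbhs_nbhs; split; [exact: oA|split => //; exact: Kc].
  have nB : nbhs y (cimg c' `&` [set z | B (cinv c' z)]).
    by apply: open_nbhs_nbhs; split; [exact: oB|split].
  exists (cimg c `&` [set z | A (cinv c z)], cimg c' `&` [set z | B (cinv c' z)]) => //.
  move=> [k' z] /= [[_ Ak'] [_ Bz]] E; rewrite E in Ak'.
  by have : (A `&` B) (cinv c' z) by []; rewrite AB.
have ic : nbhs y (cimg c').
  by apply: open_nbhs_nbhs; split => //; have [] := atlas_chart aM hc'.
apply: filterS2 ic H => z c'z Kz; split=> // -[k Kk E].
exact: Kz Kk E.
Qed.

(** The set [O] plays the part of the complement of the support: a product of
    [chi] with a function smooth on [U] is smooth on [U] and vanishes on [O],
    and these two open sets cover [M]. *)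
Lemma smooth_bump (U : set M) x : mopen U -> U x ->
  exists chi : M -> R, exists W O : set M,
  [/\ smooth_fun chi, mopen W /\ W x, forall y, W y -> chi y = 1,
      mopen O /\ (forall y, U y \/ O y) & forall y, O y -> chi y = 0].
Proof.
move=> oU Ux; have [hc cx] := chart_atP aM x; set c := chart_at x in hc cx.
have oUc : open (cimg c `&` [set y | U (cinv c y)]) by exact: oU.
have UcX : (cimg c `&` [set y | U (cinv c y)]) (cmap c x).
  by split; [exact: (cmap_cimg aM)|rewrite /= (cmapK aM)].
have [f [K [W [sf [cK KU] f0 [oW Wx] f1]]]] := bump_rV oUc UcX.
have Kc : K `<=` cimg c by move=> k /KU[].
pose chi y := if `[< cdom c y >] then f (cmap c y) else 0.
have chiE y : cdom c y -> chi y = f (cmap c y) by move=> cy; rewrite /chi asboolT.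
pose O := ~` (cinv c @` K).
have oO : mopen O by exact: compact_image_closed.
have chi0 y : O y -> chi y = 0.
  move=> Oy; rewrite /chi; case: asboolP => // cy; apply: f0 => Ky; apply: Oy.
  by exists (cmap c y) => //; exact: (cmapK aM).
have oc : mopen (cdom c) by exact: mopen_cdom.
exists chi, (cdom c `&` cmap c @^-1` W), O; split=> //.
- apply: smooth_on_local => y _; have [cy|ncy] := pselect (cdom c y).
    exists (cdom c); split => //; apply: (smooth_chart aM hc) => //.
    apply: Cinfty_eq (Cinfty_sub _ sf) => //; first exact: oc.
    by move=> z [cz dz]; rewrite /= chiE // (cinvK aM).
  exists O; split.
    by move=> -[k /Kc ck E]; apply: ncy; rewrite -E; exact: (cinv_cdom aM).
  by apply: smooth_on_eq (smooth_on_cst O 0) => // z Oz; rewrite chi0.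
- split; last by split.
  move=> c' hc'; rewrite openE => z [c'z [dz Wz]].
  have [oV sV] := atlas_compat aM hc' hc.
  have Vz : (cimg c' `&` [set y0 | cdom c (id (cinv c' y0))]) z by [].
  have cphi : {for z, continuous (cmap c \o cinv c')}.
    apply/differentiable_continuous/differentiable_rV => j.
    exact: Cinfty_diff (sV j) Vz.
  have NW : nbhs (cmap c (cinv c' z)) W by apply: open_nbhs_nbhs.
  by apply: filterS2 (open_nbhs_nbhs (conj oV Vz)) (cphi _ NW) => t [c't ct] Wt.
- by move=> y [cy Wy]; rewrite chiE // f1.
- split=> // y; have [[k Kk <-]|] := pselect ((cinv c @` K) y); last by right.
  by left; case: (KU _ Kk).
Qed.

Lemma smooth_cutoff (U O : set M) (chi f : M -> R) : mopen U -> mopen O ->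
  (forall y, U y \/ O y) -> (forall y, O y -> chi y = 0) ->
  smooth_fun chi -> smooth_on U f -> smooth_fun (fun y => chi y * f y).
Proof.
move=> oU oO UO chi0 sc sf; apply: smooth_on_local => y _; case: (UO y) => [Uy|Oy].
  by exists U; split=> //; apply: smooth_onM => //; apply: smooth_on_sub sc.
exists O; split=> //; apply: smooth_on_eq (smooth_on_cst O 0) => // z Oz.
by rewrite chi0 ?mul0r.
Qed.

End Bump.

(** * Sections of a vector bundle *)

Section Sections.
Context {R : realType} {n : nat} {M : premanifold R n} (mM : is_manifold M).
Context {r : nat} {V : vbundle M r} (hV : is_vbundle V).

Let aM := manifold_atlas mM.

Lemma frame_atP x : frames (frame_at V x) /\ fdom (frame_at V x) x.
Proof.
rewrite /frame_at; case: xgetP => [s -> //|H].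
by have [s hs] := vb_cover hV x; case: (H s).
Qed.

Lemma frame_free s x : frames s -> fdom s x -> free (@ftuple _ _ V _ s x).
Proof. by move=> hs sx; have /andP[] := vb_basis hV hs sx. Qed.

Lemma fcoord_sum (s : frame V r) x (v : V x) : frames s -> fdom s x ->
  v = \sum_a fcoord s v a *: fvec s x a.
Proof.
move=> hs sx; rewrite {1}(coord_basis (vb_basis hV hs sx) (memvf v)).
by apply: eq_bigr => a _; rewrite -tnth_nth tnth_mktuple.
Qed.

Lemma fcoord_lin (s : frame V r) x (k : 'I_r -> R) a : frames s -> fdom s x ->
  fcoord s (\sum_b k b *: fvec s x b) a = k a.
Proof.
move=> hs sx; rewrite -[RHS](coord_sum_free k a (frame_free hs sx)).
by congr (coord _ _ _); apply: eq_bigr => b _; rewrite -tnth_nth tnth_mktuple.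
Qed.

Lemma fcoord_frame (s : frame V r) x a b : frames s -> fdom s x ->
  fcoord s (fvec s x b) a = (a == b)%:R.
Proof.
move=> hs sx; rewrite -(fcoord_lin (fun b' => (b' == b)%:R) a hs sx).
rewrite (bigD1 b) //= eqxx scale1r big1 ?addr0 // => b' /negbTE ->.
exact: scale0r.
Qed.

Lemma fcoordD (s : frame V r) x (v w : V x) a :
  fcoord s (v + w) a = fcoord s v a + fcoord s w a.
Proof. exact: linearD. Qed.

Lemma fcoordZ (s : frame V r) x k (v : V x) a :
  fcoord s (k *: v) a = k * fcoord s v a.
Proof. exact: linearZ. Qed.

(** By compatibility of frames, smoothness of a section can be checked at each
    point in a single frame. *)
Lemma smooth_sec_local (z : sec V) :
  (forall x, exists s, [/\ frames s, fdom s x &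
     forall a, smooth_at x (fun y => fcoord s (z y) a)]) -> smooth_sec z.
Proof.
move=> H s' hs' a; have os' := vb_open hV hs'.
apply: smooth_on_local => x s'x; have [s [hs sx sz]] := H x.
have os := vb_open hV hs.
have : smooth_at x (fun y => \sum_b fcoord s (z y) b * fcoord s' (fvec s y b) a).
  apply: (smooth_at_sum aM) => b; apply: (smooth_atM) => //.
  exists (fdom s' `&` fdom s); split => //; last exact: vb_compat.
  exact: mopenI.
move=> [W [oW Wx HW]]; exists (W `&` fdom s); split => //.
apply: smooth_on_eq (smooth_on_sub _ HW); [exact: mopenI| |by move=> y []].
move=> y [_ sy]; rewrite [in RHS](fcoord_sum (z y) hs sy).
by rewrite /fcoord linear_sum; apply: eq_bigr => b _; rewrite linearZ.
Qed.

Lemma smooth_secD (z w : sec V) : smooth_sec z -> smooth_sec w ->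
  smooth_sec (fun x => z x + w x).
Proof.
move=> sz sw s hs a; have os := vb_open hV hs.
apply: smooth_on_eq (smooth_onD os (sz s hs a) (sw s hs a)) => // y _.
by rewrite fcoordD.
Qed.

Lemma smooth_secZ (f : M -> R) (z : sec V) : smooth_fun f -> smooth_sec z ->
  smooth_sec (fun x => f x *: z x).
Proof.
move=> sf sz s hs a; have os := vb_open hV hs.
have sf' : smooth_on (fdom s) f by apply: smooth_on_sub sf.
apply: smooth_on_eq (smooth_onM os sf' (sz s hs a)) => // y _.
by rewrite fcoordZ.
Qed.

Lemma smooth_sec0 : smooth_sec (fun x => 0 : V x).
Proof.
move=> s hs a; apply: smooth_on_eq (smooth_on_cst _ 0); first exact: vb_open.
by move=> y _; rewrite /fcoord linear0.
Qed.

Lemma smooth_sec_sum (I : Type) (l : seq I) (z : I -> sec V) :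
  (forall i, smooth_sec (z i)) -> smooth_sec (fun x => \sum_(i <- l) z i x).
Proof.
move=> H; elim: l => [|i l IH].
  have := smooth_sec0; congr smooth_sec.
  by apply: functional_extensionality_dep => x; rewrite big_nil.
have := smooth_secD (H i) IH; congr smooth_sec.
by apply: functional_extensionality_dep => x; rewrite big_cons.
Qed.

(** One-forms apply to global sections only, hence not to the members of a
    frame themselves. *)
Record extends (s : frame V r) (e : 'I_r -> sec V) (W : set M) : Prop := Extends {
  ext_smooth : forall a, smooth_sec (e a);
  ext_open : mopen W;
  ext_sub : W `<=` fdom s;
  extE : forall y a, W y -> e a y = fvec s y a }.

Lemma extension (s : frame V r) x : frames s -> fdom s x ->
  exists e W, extends s e W /\ W x.
Proof.
move=> hs sx; have os := vb_open hV hs.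
have [chi [W [P [sc [oW Wx] W1 [oP UP] P0]]]] := smooth_bump mM os sx.
exists (fun a y => chi y *: fvec s y a), (W `&` fdom s); split; last by split.
split=> //.
- move=> a s' hs' b; have os' := vb_open hV hs'.
  apply: smooth_on_local => y s'y; case: (UP y) => [sy|Py].
    exists (fdom s' `&` fdom s); split => //.
    have sc' := smooth_on_sub (O := fdom s' `&` fdom s) (fun _ _ => I) sc.
    have H := smooth_onM (mopenI os' os) sc' (vb_compat hV hs' hs b a).
    by apply: smooth_on_eq H; [exact: mopenI|move=> z _; rewrite fcoordZ].
  exists P; split=> //; apply: smooth_on_eq (smooth_on_cst P 0) => // z Pz.
  by rewrite P0 // scale0r /fcoord linear0.
- exact: mopenI.
- by move=> y a [Wy _]; rewrite W1 // scale1r.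
Qed.

End Sections.

(** * One-forms on sections and fibrewise linear functions *)

Section Forms.
Context {R : realType} {n : nat} {M : premanifold R n} (mM : is_manifold M).
Context {r : nat} {V : vbundle M r} (hV : is_vbundle V).

Let aM := manifold_atlas mM.

Lemma extension_sum (s : frame V r) e W y (v : V y) : frames s ->
  extends s e W -> W y -> v = \sum_a fcoord s v a *: e a y.
Proof.
move=> hs he Wy; rewrite [LHS](fcoord_sum hV v hs (ext_sub he Wy)).
by apply: eq_bigr => a _; rewrite (extE he).
Qed.

Lemma sec_through x (v : V x) : exists z : sec V, smooth_sec z /\ z x = v.
Proof.
have [hs sx] := frame_atP hV x; have [e [W [he Wx]]] := extension mM hV hs sx.
exists (fun y => \sum_a fcoord (frame_at V x) v a *: e a y); split.
  apply: (smooth_sec_sum hV) => a; apply: (smooth_secZ hV (smooth_on_cst _ _)).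
  exact: ext_smooth he a.
by rewrite -(extension_sum v hs he Wx).
Qed.

Section OneForm.
Context (omega : sec V -> M -> R) (Lo : Lambda1 omega).

Lemma Lambda1_0 : omega (fun x => 0) = fun=> 0.
Proof.
have := Lambda1_scale Lo (smooth_on_cst setT 0) (smooth_sec0 hV).
rewrite (_ : (fun x => 0 *: 0) = (fun x => 0)); last first.
  by apply: functional_extensionality_dep => x; rewrite scaler0.
by move=> ->; apply/funext => x; rewrite mul0r.
Qed.

Lemma Lambda1_sum (I : Type) (l : seq I) (z : I -> sec V) :
  (forall i, smooth_sec (z i)) ->
  omega (fun x => \sum_(i <- l) z i x) = fun x => \sum_(i <- l) omega (z i) x.
Proof.
move=> H; elim: l => [|i l IH].
  rewrite (_ : (fun x => _) = (fun x => 0)).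
    by rewrite Lambda1_0; apply/funext => x; rewrite big_nil.
  by apply: functional_extensionality_dep => x; rewrite big_nil.
rewrite (_ : (fun x => _) = (fun x => z i x + \sum_(i <- l) z i x)).
  rewrite (Lambda1_add Lo) ?IH //; last exact: (smooth_sec_sum hV).
  by apply/funext => x; rewrite big_cons.
by apply: functional_extensionality_dep => x; rewrite big_cons.
Qed.

(** For a cutoff [chi] supported in [D], [chi v] and [chi w] are the same
    section, and [omega] takes out the factor [chi], which is 1 at [x]. *)
Lemma Lambda1_local (v w : sec V) D x : smooth_sec v -> smooth_sec w ->
  mopen D -> D x -> (forall y, D y -> v y = w y) -> omega v x = omega w x.
Proof.
move=> sv sw oD Dx E.
have [chi [W [P [sc [oW Wx] W1 [oP UP] P0]]]] := smooth_bump mM oD Dx.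
have := congr1 (fun f => f x) (Lambda1_scale Lo sc sv).
have := congr1 (fun f => f x) (Lambda1_scale Lo sc sw).
rewrite /= (W1 x Wx) !mul1r => <- <-; congr omega.
apply: functional_extensionality_dep => y; case: (UP y) => [Dy|/P0 ->].
  by rewrite E.
by rewrite !scale0r.
Qed.

(** The coefficients of [v] on the frame are not globally defined; multiplied
    by a cutoff they are, and by locality this does not change [omega v] near
    the point. *)
Lemma Lambda1_frame (s : frame V r) e W y (v : sec V) : frames s ->
  extends s e W -> W y -> smooth_sec v ->
  omega v y = \sum_a fcoord s (v y) a * omega (e a) y.
Proof.
move=> hs he Wy sv; have oW := ext_open he.
have [chi [W' [P [sc [oW' W'y] W1 [oP UP] P0]]]] := smooth_bump mM oW Wy.
have sf a : smooth_fun (fun y => chi y * fcoord s (v y) a).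
  apply: (smooth_cutoff oW oP UP P0 sc).
  by apply: smooth_on_sub (sv s hs a); exact: ext_sub he.
pose z a y := (chi y * fcoord s (v y) a) *: e a y.
have sz a : smooth_sec (z a).
  by apply: (smooth_secZ hV (sf a)); exact: ext_smooth he a.
have -> : omega v y = omega (fun x => \sum_a z a x) y.
  apply: (@Lambda1_local _ _ (W' `&` W)) => //.
  - exact: (smooth_sec_sum hV).
  - exact: mopenI.
  move=> t [W't Wt]; rewrite (extension_sum (v t) hs he Wt).
  by apply: eq_bigr => a _; rewrite /z W1 // mul1r.
rewrite (Lambda1_sum _ sz); apply: eq_bigr => a _.
rewrite /z (Lambda1_scale Lo (sf a) (ext_smooth he a)).
by rewrite W1 // mul1r.
Qed.

(** The components of [omega] on the frame chosen at a point exist and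
    determine its values there, so [hat] does not depend on the choices made
    in its definition. *)
Lemma hatE (v : tot V) (z : sec V) : smooth_sec z -> z (bproj v) = projT2 v ->
  hat omega v = omega z (bproj v).
Proof.
case: v => x v; rewrite /bproj /= => sz zx.
have [hs sx] := frame_atP hV x; have [e [W [he Wx]]] := extension mM hV hs sx.
rewrite /hat /bproj /= /Lambda1_comp; case: xgetP => [w _ /= Hw|/= noP].
  by rewrite (Hw z sz) zx; apply: eq_bigr => a _; rewrite mulrC.
case: (noP (\row_a omega (e a) x)) => z' sz' /=.
rewrite (Lambda1_frame hs he Wx sz'); apply: eq_bigr => a _.
by rewrite mxE mulrC.
Qed.

Lemma hat_frame (s : frame V r) e W (v : tot V) : frames s ->
  extends s e W -> W (bproj v) ->
  hat omega v = \sum_a fcoord s (projT2 v) a * omega (e a) (bproj v).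
Proof.
move=> hs he Wv; have [z [sz zx]] := sec_through (projT2 v).
by rewrite (hatE sz zx) (Lambda1_frame hs he Wv sz) zx.
Qed.

End OneForm.

Lemma eq_hat (omega omega' : sec V -> M -> R) :
  (forall v, smooth_sec v -> omega v = omega' v) -> hat omega = hat omega'.
Proof.
move=> E; apply/funext => v; rewrite /hat; apply: eq_bigr => a _; congr (_ * _).
rewrite /Lambda1_comp; congr (fun_of_matrix (xget 0 _) 0 a); apply/seteqP.
by split=> w /= Hw z sz; [rewrite -E|rewrite E] => //; exact: Hw.
Qed.

(** A coframe, cut off so as to act on all sections; these forms realize the
    fibre coordinates as functions of the form [hat theta]. *)
Lemma dual_forms (s : frame V r) x : frames s -> fdom s x ->
  exists (theta : 'I_r -> sec V -> M -> R) (W : set M),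
  [/\ mopen W, W x, W `<=` fdom s, forall b, Lambda1 (theta b) &
      forall b v y, W y -> theta b v y = fcoord s (v y) b].
Proof.
move=> hs sx; have os := vb_open hV hs.
have [chi [W [P [sc [oW Wx] W1 [oP UP] P0]]]] := smooth_bump mM os sx.
exists (fun b v y => chi y * fcoord s (v y) b), (W `&` fdom s).
split=> //; first exact: mopenI.
- move=> b; split=> [v sv|v w sv sw|f v sf sv].
  + by apply: (smooth_cutoff os oP UP P0 sc); exact: sv.
  + by apply/funext => y; rewrite fcoordD mulrDr.
  + by apply/funext => y; rewrite fcoordZ mulrCA.
- by move=> b v y [Wy _]; rewrite W1 // mul1r.
Qed.

Lemma hat_dual (s : frame V r) (theta : sec V -> M -> R) b (W : set M) (v : tot V) :
  Lambda1 theta -> (forall z y, W y -> theta z y = fcoord s (z y) b) ->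
  W (bproj v) -> hat theta v = fcoord s (projT2 v) b.
Proof.
move=> Lt E Wv; have [z [sz zx]] := sec_through (projT2 v).
by rewrite (hatE Lt sz zx) E // zx.
Qed.

End Forms.

(** * The total space *)

Section Tot.
Context {R : realType} {n : nat} {M : premanifold R n} (aM : atlas M).
Context {r : nat} {V : vbundle M r} (hV : is_vbundle V).

Lemma open_lsubmx (O : set 'rV[R]_n) : open O -> open [set y : 'rV[R]_(n + r) | O (lsubmx y)].
Proof.
by move=> oO; apply: open_comp => // y _; exact: continuous_lsubmx.
Qed.

Lemma Cinfty_lsubmx (O : set 'rV[R]_n) f : open O -> Cinfty O f ->
  Cinfty [set y : 'rV[R]_(n + r) | O (lsubmx y)] (f \o lsubmx).
Proof.
move=> oO Hf; apply: Cinfty_comp Hf => //; first exact: open_lsubmx.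
move=> j k; have -> : (fun y : 'rV[R]_(n + r) => lsubmx y 0 j) = (fun y => y 0 (lshift r j)).
  by apply/funext => y; rewrite mxE.
exact: Ck_coord.
Qed.

Lemma tot_charts (C : @chart R (tot V) (n + r)) : charts C <->
  exists c s, [/\ charts (p := M) c, frames (v := V) s & C = tot_chart c s].
Proof.
split=> [[[c s] [/= hc hs] <-]|[c [s [hc hs ->]]]]; first by exists c, s.
by exists (c, s).
Qed.

Lemma tot_atlas : atlas (tot V).
Proof.
split.
- move=> C /tot_charts[c [s [hc hs ->]]]; have os := vb_open hV hs.
  split.
  + exact: (open_lsubmx (os c hc)).
  + case=> x v /= [cx sx]; rewrite row_mxKl row_mxKr (cmapK aM) //; split.
      by split=> //; exact: (cmap_cimg aM).
    congr existT; rewrite [RHS](fcoord_sum hV v hs sx).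
    by apply: eq_bigr => a _; rewrite mxE.
  + move=> y /= [cy sy]; split; first by split=> //; exact: (cinv_cdom aM).
    rewrite (cinvK aM) // -[RHS]hsubmxK; congr row_mx.
    by apply/rowP => a; rewrite mxE (fcoord_lin hV).
- move=> C C' /tot_charts[c [s [hc hs ->]]] /tot_charts[c' [s' [hc' hs' ->]]].
  have os := vb_open hV hs; have os' := vb_open hV hs'.
  have oc' := mopen_cdom aM hc'.
  pose D := fdom s `&` (cdom c' `&` fdom s').
  have oD : mopen D by do !apply: mopenI.
  have oW := open_lsubmx (oD c hc).
  have WE : cimg (tot_chart c s) `&` [set y | cdom (tot_chart c' s') (id (cinv (tot_chart c s) y))]
     = [set y : 'rV[R]_(n + r) | (cimg c `&` [set z | D (cinv c z)]) (lsubmx y)].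
    by apply/seteqP; split => y /=; [move=> [[? ?] []]|move=> [? [? []]]].
  rewrite /compat /smooth_in WE; split=> // j.
  case: (splitP j) => [i ji|a ja].
    have -> : j = lshift r i by apply: val_inj.
    have H := smooth_on_sub (fun x (H : D x) => H.2.1) (smooth_coord aM i hc').
    have := Cinfty_lsubmx (oD c hc) (H c hc).
    by apply: Cinfty_eq => // y _; rewrite /= row_mxEl.
  have -> : j = rshift n a by apply: val_inj.
  have H b : Cinfty [set y : 'rV[R]_(n + r) | (cimg c `&` [set z | D (cinv c z)]) (lsubmx y)]
     (fun y => y 0 (rshift n b) * fcoord s' (fvec s (cinv c (lsubmx y)) b) a).
    move=> k; apply: CkM => //; first exact: Ck_coord.
    have H := smooth_on_sub _ (vb_compat hV hs' hs a b).
    by apply: (Cinfty_lsubmx (oD c hc) (H D _ c hc)) => x [? []].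
  have := fun k => Ck_sum oW (fun b => H b k).
  apply: Cinfty_eq => // y _; rewrite /= row_mxEr mxE /fcoord linear_sum.
  by apply: eq_bigr => b _; rewrite linearZ /= mxE.
- case=> x v; have [c [hc cx]] := atlas_cover aM x.
  have [s [hs sx]] := vb_cover hV x.
  by exists (tot_chart c s); split=> //; apply/tot_charts; exists c, s.
Qed.

Lemma bproj_smooth : smooth_map (@bproj R n M r V).
Proof.
move=> C c' /tot_charts[c [s [hc hs ->]]] hc'.
have os := vb_open hV hs; have oc' := mopen_cdom aM hc'.
pose D := fdom s `&` cdom c'.
have oD : mopen D by exact: mopenI.
have oW := open_lsubmx (oD c hc).
have WE : cimg (tot_chart c s) `&` [set y | cdom c' (bproj (E := V) (cinv (tot_chart c s) y))]
     = [set y : 'rV[R]_(n + r) | (cimg c `&` [set z | D (cinv c z)]) (lsubmx y)].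
  by apply/seteqP; split => y /=; [move=> [[? ?] ?]|move=> [? []]].
rewrite /smooth_in WE; split=> // j.
have H := smooth_on_sub (fun x (H : D x) => H.2) (smooth_coord aM j hc').
by have := Cinfty_lsubmx (oD c hc) (H c hc).
Qed.

Lemma smooth_fibre_coord (s : frame V r) v a : frames s -> fdom s (bproj v) ->
  smooth_at v (fun w : tot V => fcoord s (projT2 w) a).
Proof.
move=> hs sv; have [c [hc cv]] := atlas_cover aM (bproj v).
have hC : charts (p := tot V) (tot_chart c s) by apply/tot_charts; exists c, s.
have H := smooth_coord tot_atlas (rshift n a) hC.
exists (cdom (tot_chart c s)); split=> //; first exact: (mopen_cdom tot_atlas).
apply: smooth_on_eq H; first exact: (mopen_cdom tot_atlas).
by move=> w _; rewrite /= row_mxEr mxE.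
Qed.

End Tot.

(** * Lifting a derivation of a vector bundle to its total space *)

(** In this section [X] is a vector field and [B] a derivation of the bundle
    [V] over [X]. *)
Section Lift.
Context {R : realType} {n : nat} {M : premanifold R n} (mM : is_manifold M).
Context {r : nat} {V : vbundle M r} (hV : is_vbundle V).
Context (X : sec (tangent M)) (B : sec V -> sec V).
Hypothesis sX : smooth_sec X.
Hypothesis hB : forall v, smooth_sec v -> smooth_sec (B v).
Hypothesis hBD : forall v w, smooth_sec v -> smooth_sec w ->
  B (fun x => v x + w x) = fun x => B v x + B w x.
Hypothesis hBZ : forall f v, smooth_fun f -> smooth_sec v ->
  B (fun x => f x *: v x) = fun x => f x *: B v x + act X f x *: v x.

Let aM := manifold_atlas mM.
Let aT := tot_atlas aM hV.
Let pi := @bproj R n M r V.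
Let spi : smooth_map pi := bproj_smooth aM hV.

Let hX D f : mopen D -> smooth_on D f -> smooth_on D (act X f).
Proof. exact: act_smooth. Qed.

(** The derivation of one-forms dual to [B]. *)
Definition form_derivative (omega : sec V -> M -> R) (v : sec V) (x : M) : R :=
  act X (omega v) x - omega (B v) x.

(** Both terms are derivations over [X], and their difference is linear over
    functions. *)
Lemma Lambda1_derivative omega : Lambda1 omega -> Lambda1 (form_derivative omega).
Proof.
move=> Lo; have oT := mopenT aM; split=> [v sv|v w sv sw|f v sf sv].
- apply: smooth_onB => //; first exact: (hX oT (Lambda1_smooth Lo sv)).
  exact: (Lambda1_smooth Lo (hB sv)).
- apply/funext => x; rewrite /form_derivative hBD // !(Lambda1_add Lo) //; try exact: hB.
  have A z : smooth_sec z -> smooth_at x (omega z).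
    by move=> sz; exact: smooth_fun_at (Lambda1_smooth Lo sz).
  by rewrite !actE (tderiveD aM (X x) (A v sv) (A w sw)) addrACA -opprD.
- apply/funext => x; rewrite /form_derivative hBZ //.
  have sfv := Lambda1_smooth Lo sv.
  have sXf : smooth_fun (act X f) by exact: hX.
  rewrite (Lambda1_add Lo); [|exact: (smooth_secZ hV sf (hB sv))|exact: smooth_secZ].
  rewrite !(Lambda1_scale Lo) //; last exact: hB.
  rewrite !actE (tderiveM aM (X x) (smooth_fun_at aM x sf) (smooth_fun_at aM x sfv)).
  by rewrite mulrBr opprD addrACA [_ * tderive _ _ _ in X in _ + X]mulrC subrr addr0.
Qed.

(** Locally [hat omega] is a sum of products of fibre coordinates with the
    functions [omega (e a)]. *)
Lemma hat_smooth (omega : sec V -> M -> R) : Lambda1 omega ->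
  smooth_fun (M := tot V) (hat omega).
Proof.
move=> Lo; apply: smooth_on_local => v _; have [hs sv] := frame_atP hV (pi v).
have [e [W [he Wv]]] := extension mM hV hs sv; have oW := ext_open he.
have oP := mopen_preimage aM spi oW.
have : smooth_at v (fun w : tot V =>
    \sum_a fcoord (frame_at V (pi v)) (projT2 w) a * (omega (e a) \o pi) w).
  apply: (smooth_at_sum aT) => a; apply: smooth_atM.
    exact: smooth_fibre_coord.
  apply: (smooth_at_comp aM spi); apply: (smooth_fun_at aM).
  exact: (Lambda1_smooth Lo (ext_smooth he a)).
move=> [P [oP' Pv sP]]; exists (P `&` pi @^-1` W); split=> //.
apply: smooth_on_eq (smooth_on_sub _ sP); [exact: mopenI| |by move=> ? []].
by move=> w [_ Ww]; rewrite (hat_frame mM hV Lo hs he Ww).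
Qed.

(** The two conditions on the lift, at one point: they only involve the value
    of the field there. *)
Definition is_lift (v : tot V) (w : 'rV[R]_(n + r)) : Prop :=
  (forall f, smooth_at (pi v) f -> tderive v w (f \o pi) = tderive (pi v) (X (pi v)) f) /\
  (forall omega : sec V -> M -> R, Lambda1 omega ->
     tderive v w (hat omega) = hat (form_derivative omega) v).

Lemma lift_base v w : is_lift v w ->
  forall f, smooth_at (pi v) f -> tderive v w (f \o pi) = tderive (pi v) (X (pi v)) f.
Proof. by case. Qed.

(** Near [v] the fibre coordinate is [hat theta], whose derivative along a lift
    is prescribed. *)
Lemma lift_fibre v w (s : frame V r) b theta (W : set M) : frames s ->
  mopen W -> W (pi v) -> W `<=` fdom s -> Lambda1 theta ->
  (forall z y, W y -> theta z y = fcoord s (z y) b) -> is_lift v w ->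
  tderive v w (fun u => fcoord s (projT2 u) b) = hat (form_derivative theta) v.
Proof.
move=> hs oW Wv Ws Lt E [_ <-]; last exact: Lt.
apply: (tderive_eq aT (D := pi @^-1` W)) => //; first exact: (mopen_preimage aM spi).
  by move=> u Wu; rewrite (hat_dual mM hV Lt E Wu).
by apply: (smooth_fibre_coord aM hV _ hs); exact: Ws.
Qed.

(** The base coordinates are functions pulled back from [M], and the fibre
    coordinates are locally of the form [hat theta]. *)
Lemma lift_unique v w w' : is_lift v w -> is_lift v w' -> w = w'.
Proof.
move=> Hw Hw'; have [hC Cv] := chart_atP aT v.
have [c [s [hc hs EC]]] := (tot_charts (chart_at v)).1 hC.
have [cv sv] : cdom c (pi v) /\ fdom s (pi v) by move: Cv; rewrite EC.
apply/rowP => j; rewrite -!(tderive_coord_at aT v) EC.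
case: (splitP j) => [i ji|b jb].
  have -> : j = lshift r i by apply: val_inj.
  have -> : (fun y => cmap (tot_chart c s) y 0 (lshift r i)) = (fun x => cmap c x 0 i) \o pi.
    by apply/funext => u; rewrite /= row_mxEl.
  have sc := smooth_on_at (mopen_cdom aM hc) cv (smooth_coord aM i hc).
  by rewrite (lift_base Hw sc) (lift_base Hw' sc).
have -> : j = rshift n b by apply: val_inj.
have -> : (fun y => cmap (tot_chart c s) y 0 (rshift n b)) = (fun u => fcoord s (projT2 u) b).
  by apply/funext => u; rewrite /= row_mxEr mxE.
have [theta [W [oW Wx Ws Lt E]]] := dual_forms mM hV hs sv.
by rewrite !(lift_fibre hs oW Wx Ws (Lt b) (E b)).
Qed.

(** [hat omega] is locally the sum of the products of fibre coordinates with
    functions pulled back from [M]; by the product rule its derivative is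
    right as soon as those of both factors are. *)
Lemma lift_exists v : exists w, is_lift v w.
Proof.
have [hC Cv] := chart_atP aT v.
have [c [s [hc hs EC]]] := (tot_charts (chart_at v)).1 hC.
have [cv sv] : cdom c (pi v) /\ fdom s (pi v) by move: Cv; rewrite EC.
have [e [W [he Wv]]] := extension mM hV hs sv; have oW := ext_open he.
set x := pi v in cv sv Wv.
(* The fibre components are [hat (form_derivative theta) v] for [theta] the
   coframe form of index [b]: as [theta (e a)] is locally constant, only the
   term with [B] remains. *)
pose w : 'rV[R]_(n + r) := row_mx (\row_i tderive x (X x) (fun y => cmap c y 0 i))
  (\row_b - \sum_a fcoord s (projT2 v) a * fcoord s (B (e a) x) b).
have sc i := smooth_on_at (mopen_cdom aM hc) cv (smooth_coord aM i hc).
have wl i : tderive v w ((fun y => cmap c y 0 i) \o pi) = tderive x (X x) (fun y => cmap c y 0 i).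
  have -> : (fun y => cmap c y 0 i) \o pi = (fun y => cmap (chart_at v) y 0 (lshift r i)).
    by rewrite EC; apply/funext => u; rewrite /= row_mxEl.
  by rewrite (tderive_coord_at aT) row_mxEl mxE.
have wr b : tderive v w (fun u => fcoord s (projT2 u) b) =
    - \sum_a fcoord s (projT2 v) a * fcoord s (B (e a) x) b.
  have -> : (fun u : tot V => fcoord s (projT2 u) b)
      = (fun y => cmap (chart_at v) y 0 (rshift n b)).
    by rewrite EC; apply/funext => u; rewrite /= row_mxEr mxE.
  by rewrite (tderive_coord_at aT) row_mxEr mxE.
have base f : smooth_at x f -> tderive v w (f \o pi) = tderive x (X x) f.
  move=> sf; rewrite -(tderive_tmap aT aM spi) // !(tderive_chart aM _ hc cv sf).
  by apply: eq_bigr => i _; rewrite (tderive_tmap aT aM spi) // wl.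
exists w; split=> // omega Lo.
have so a : smooth_at x (omega (e a)).
  by apply: (smooth_fun_at aM); exact: (Lambda1_smooth Lo (ext_smooth he a)).
have so' a := smooth_at_comp aM spi (so a).
have sp a := smooth_fibre_coord aM hV a hs sv.
have spo a := smooth_atM (sp a) (so' a).
rewrite -(tderive_eq aT w (D := pi @^-1` W) (f := fun u : tot V =>
    \sum_a fcoord s (projT2 u) a * (omega (e a) \o pi) u)) //; last 3 first.
- exact: (mopen_preimage aM spi).
- by move=> u Wu; rewrite (hat_frame mM hV Lo hs he Wu).
- exact: (smooth_at_sum aT).
rewrite (tderive_sum aT) //.
rewrite (hat_frame mM hV (Lambda1_derivative Lo) hs he Wv) -/x.
under eq_bigr do rewrite (tderiveM aT _ (sp _) (so' _)) base // wr.
under [RHS]eq_bigr do rewrite /form_derivative mulrBr.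
rewrite big_split sumrB /=; congr (_ + _).
under eq_bigr do rewrite mulrN mulr_sumr; rewrite sumrN; congr (- _).
rewrite exchange_big /=; apply: eq_bigr => a _.
rewrite (Lambda1_frame mM hV Lo hs he Wv (hB (ext_smooth he a))) mulr_sumr.
by apply: eq_bigr => b _; rewrite mulrCA [omega _ _ * _]mulrC.
Qed.

(** In a chart of the total space the components of a lift are [X] applied to
    the base coordinates, pulled back, and locally the functions
    [hat (form_derivative theta)]. *)
Lemma lift_smooth (uc : sec (tangent (tot V))) :
  (forall v, is_lift v (uc v)) -> smooth_sec uc.
Proof.
move=> Hu; apply/(smooth_secT aT) => C j hC.
have [c [s [hc hs EC]]] := (tot_charts C).1 hC.
apply: smooth_on_local => v Cv.
have [cv sv] : cdom c (pi v) /\ fdom s (pi v) by move: Cv; rewrite EC.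
have oC := mopen_cdom aT hC.
case: (splitP j) => [i ji|b jb].
  have Ej : j = lshift r i by apply: val_inj.
  have H := smooth_on_comp aM spi (mopen_cdom aM hc) (hX (mopen_cdom aM hc) (smooth_coord aM i hc)).
  exists (cdom C); split=> //; apply: smooth_on_eq (smooth_on_sub _ H) => //.
    move=> u Cu.
    have cu : cdom c (pi u) by move: Cu; rewrite EC => -[].
    have sc := smooth_on_at (mopen_cdom aM hc) cu (smooth_coord aM i hc).
    rewrite /= -[LHS]/(tderive (pi u) (X (pi u)) (fun y => cmap c y 0 i)) -(lift_base (Hu u) sc).
    by congr tderive; apply/funext => y; rewrite EC Ej /= row_mxEl.
  by move=> u; rewrite EC => -[].
have Ej : j = rshift n b by apply: val_inj.
have [theta [W [oW Wx Ws Lt E]]] := dual_forms mM hV hs sv.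
have H := hat_smooth (Lambda1_derivative (Lt b)).
have oP := mopen_preimage aM spi oW.
exists (cdom C `&` pi @^-1` W); split=> //.
apply: smooth_on_eq (smooth_on_sub _ H) => //; first exact: mopenI.
move=> u [Cu Wu]; rewrite -(lift_fibre hs oW Wu Ws (Lt b) (E b) (Hu u)).
by congr tderive; apply/funext => y; rewrite EC Ej /= row_mxEr mxE.
Qed.

End Lift.

(** * The dual bundle *)

Section Dual.
Context {R : realType} {n : nat} {M : premanifold R n}.
Context {r : nat} {E : vbundle M r} (hE : is_vbundle E).

Lemma dual_frameE (s : frame E r) x a v : fvec (dual_frame s) x a v = fcoord s v a.
Proof. by rewrite /= (lfunE (coord (ftuple s x) a : {linear _ -> R^o})). Qed.

Lemma dual_frame_sum (s : frame E r) x (phi : dual E x) : frames s -> fdom s x ->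
  phi = \sum_a phi (fvec s x a) *: fvec (dual_frame s) x a.
Proof.
move=> hs sx; apply/lfunP => v; rewrite sum_lfunE [in LHS](fcoord_sum hE v hs sx).
rewrite linear_sum; apply: eq_bigr => a _.
by rewrite linearZ scale_lfunE dual_frameE; exact: mulrC.
Qed.

Lemma dual_frame_basis (s : frame E r) x : frames s -> fdom s x ->
  basis_of fullv (ftuple (dual_frame s) x).
Proof.
move=> hs sx; apply/andP; split.
  rewrite eqEsubv subvf /=; apply/subvP => phi _.
  rewrite (dual_frame_sum phi hs sx); apply: memv_suml => a _; apply: memvZ.
  apply: memv_span; rewrite -[X in X \in _](tnth_mktuple (fvec (dual_frame s) x)).
  exact: mem_tnth.
apply/freeP => k k0 b.
have E0 : \sum_i k i *: fvec (dual_frame s) x i = 0.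
  by rewrite -[RHS]k0; apply: eq_bigr => i _; rewrite -tnth_nth tnth_mktuple.
have := congr1 (fun phi : dual E x => phi (fvec s x b)) E0.
rewrite sum_lfunE zero_lfunE => <-.
have T i : (k i *: fvec (dual_frame s) x i : dual E x) (fvec s x b) = k i * (b == i)%:R.
  by rewrite scale_lfunE dual_frameE (fcoord_frame hE) // eq_sym.
rewrite (bigD1 b) //= -[X in X + _]/((k b *: fvec (dual_frame s) x b : dual E x) (fvec s x b)).
rewrite T eqxx mulr1 big1 ?addr0 // => i ib; apply: etrans (T i) _.
by rewrite eq_sym (negbTE ib) mulr0.
Qed.

(** The frame dual to the dual frame consists of the evaluations at [s]. *)
Lemma dual_fcoord (s : frame E r) x (phi : dual E x) a : frames s -> fdom s x ->
  fcoord (dual_frame s) phi a = phi (fvec s x a).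
Proof.
move=> hs sx; have /andP[_ fr] := dual_frame_basis hs sx.
rewrite -(coord_sum_free (fun a => phi (fvec s x a)) a fr) /fcoord.
rewrite {1}(dual_frame_sum phi hs sx); congr (coord _ _ _).
by apply: eq_bigr => b _; rewrite -tnth_nth tnth_mktuple.
Qed.

Lemma dual_vbundle : is_vbundle (dual E).
Proof.
split.
- by move=> _ [s hs <-]; exact: (vb_open hE hs).
- by move=> _ x [s hs <-] sx; exact: dual_frame_basis.
- move=> x; have [s [hs sx]] := vb_cover hE x.
  by exists (dual_frame s); split => //; exists s.
- move=> _ _ [s hs <-] [s' hs' <-] a b.
  have H := smooth_on_sub _ (vb_compat hE hs' hs b a).
  apply: smooth_on_eq (H (fdom s `&` fdom s') _).
  + by apply: mopenI; exact: vb_open.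
  + move=> x [sx s'x]; rewrite -(dual_frameE s' b).
    by rewrite dual_fcoord.
  + by move=> x [].
Qed.

End Dual.

(** * Transport of sections along a bundle isomorphism *)

(* The bare name also denotes a fact about the derivative of an inverse. *)
Local Notation dinv := Defs.dinv.

Section Morphism.
Context {R : realType} {m : nat} {M N : premanifold R m}.
Context (mM : is_manifold M) (mN : is_manifold N).
Context (h : diffeo M N) {r p : nat} {V : vbundle M r} {F : vbundle N p}.
Context (hV : is_vbundle V) (hF : is_vbundle F) (g : vbmorph V F h).
Context (hg : locally_invertible g).

Let aM := manifold_atlas mM.
Let aN := manifold_atlas mN.
Let sh : smooth_map h := @dfun_smooth _ _ _ _ h.
Let sh' : smooth_map (dinv h) := @dinv_smooth _ _ _ _ h.

(** The cast in [push_sec] disappears at points of the form [h x]; as [h] is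
    onto, such points suffice. *)
Lemma push_secE (u : sec V) x : push_sec g u (h x) = g x (u x).
Proof.
rewrite /push_sec; move: (dinvK h (h x)); rewrite (dfunK h x) => e.
by rewrite (Prop_irrelevance e erefl).
Qed.

Lemma push_secD (v w : sec V) :
  push_sec g (fun x => v x + w x) = fun y => push_sec g v y + push_sec g w y.
Proof.
apply: functional_extensionality_dep => y; rewrite -(dinvK h y).
by rewrite !push_secE linearD.
Qed.

Lemma push_secZ (f : M -> R) (v : sec V) :
  push_sec g (fun x => f x *: v x) = fun y => f (dinv h y) *: push_sec g v y.
Proof.
apply: functional_extensionality_dep => y; rewrite -(dinvK h y).
by rewrite !push_secE linearZ dfunK.
Qed.

Lemma fcoord_morph (s : frame V r) (t : frame F p) x (v : V x) alpha :
  frames s -> fdom s x ->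
  fcoord t (g x v) alpha = \sum_b mcomp g s t x alpha b * fcoord s v b.
Proof.
move=> hs sx; rewrite {1}(fcoord_sum hV v hs sx) linear_sum /fcoord linear_sum.
by apply: eq_bigr => b _; rewrite !linearZ /= !mxE mulrC.
Qed.

Lemma mcomp_col (s : frame V r) (t : frame F p) x (v : V x) : frames s -> fdom s x ->
  \col_alpha fcoord t (g x v) alpha = mcomp g s t x *m \col_b fcoord s v b.
Proof.
move=> hs sx; apply/colP => alpha; rewrite 2!mxE (fcoord_morph t v alpha hs sx).
by apply: eq_bigr => b _; congr (_ * _); rewrite mxE.
Qed.

Lemma push_smooth (u : sec V) : smooth_sec u -> smooth_sec (push_sec g u).
Proof.
move=> su; apply: (smooth_sec_local mN hF) => y.
have [ht ty] := frame_atP hF y; set t := frame_at F y in ht ty.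
have [hs sx] := frame_atP hV (dinv h y); set s := frame_at V (dinv h y) in hs sx.
exists t; split=> // alpha.
have oD : mopen (fdom s `&` h @^-1` fdom t).
  by apply: mopenI; [exact: vb_open|apply: (mopen_preimage aN sh); exact: vb_open].
have Dx : (fdom s `&` h @^-1` fdom t) (dinv h y) by split; rewrite //= dinvK.
have sk : smooth_at (dinv h y) (fun x => \sum_b mcomp g s t x alpha b * fcoord s (u x) b).
  apply: (smooth_at_sum aM) => b; apply: smooth_atM.
    by apply: (smooth_on_at oD Dx); exact: fibmap_smooth.
  by apply: (smooth_on_at _ sx (su s hs b)); exact: vb_open.
have [W [oW Wy HW]] := smooth_at_comp aM sh' sk.
have oD' := mopen_preimage aM sh' oD.
exists (W `&` dinv h @^-1` (fdom s `&` h @^-1` fdom t)); split=> //.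
  exact: mopenI.
apply: smooth_on_eq (smooth_on_sub _ HW); [exact: mopenI| |by move=> ? []].
move=> z [_ [sz _]]; rewrite -[in RHS](dinvK h z) push_secE.
by rewrite (fcoord_morph t _ alpha hs sz).
Qed.

(** Invertibility of the matrix of [g x] makes it bijective, so that the
    one-sided inverse of linear maps used in [pull_sec] is the inverse. *)
Lemma fibre_inverse (s : frame V r) (t : frame F p) (gt : 'M[R]_(r, p)) x (z : F (h x)) :
  frames s -> frames t -> fdom s x -> fdom t (h x) ->
  gt *m mcomp g s t x = 1%:M -> mcomp g s t x *m gt = 1%:M ->
  lker (g x) == 0%VS /\
  \col_b fcoord s ((g x)^-1%VF z) b = gt *m \col_alpha fcoord t z alpha.
Proof.
move=> hs ht sx tx gl gr.
have gi : lker (g x) == 0%VS.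
  apply/lker0P => v w E.
  have C : \col_b fcoord s v b = \col_b fcoord s w b.
    by rewrite -[LHS]mul1mx -[RHS]mul1mx -gl -!mulmxA -!(mcomp_col t _ hs sx) E.
  rewrite (fcoord_sum hV v hs sx) (fcoord_sum hV w hs sx).
  by apply: eq_bigr => b _; have /colP/(_ b) := C; rewrite !mxE => ->.
split=> //; set c := gt *m _.
pose v := \sum_b c b 0 *: fvec s x b.
have cv : \col_b fcoord s v b = c.
  by apply/colP => b; rewrite mxE (fcoord_lin hV).
have gv : g x v = z.
  have C : \col_alpha fcoord t (g x v) alpha = \col_alpha fcoord t z alpha.
    by rewrite (mcomp_col t v hs sx) cv /c mulmxA gr mul1mx.
  rewrite (fcoord_sum hF (g x v) ht tx) [RHS](fcoord_sum hF z ht tx).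
  by apply: eq_bigr => b _; have /colP/(_ b) := C; rewrite !mxE => ->.
by rewrite -gv lker0_lfunK.
Qed.

Lemma fibre_injective x : lker (g x) == 0%VS.
Proof.
have [hs sx] := frame_atP hV x; have [ht tx] := frame_atP hF (h x).
have [gt [_ Hgt]] := hg hs ht; have [gl gr] := Hgt x (conj sx tx).
by have [] := fibre_inverse 0 hs ht sx tx gl gr.
Qed.

Lemma pull_smooth (z : sec F) : smooth_sec z -> smooth_sec (pull_sec g z).
Proof.
move=> sz; apply: (smooth_sec_local mM hV) => x.
have [hs sx] := frame_atP hV x; have [ht tx] := frame_atP hF (h x).
set s := frame_at V x in hs sx; set t := frame_at F (h x) in ht tx.
have [gt [sgt Hgt]] := hg hs ht.
have ot : mopen (h @^-1` fdom t) by apply: (mopen_preimage aN sh); exact: vb_open.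
have oD : mopen (fdom s `&` h @^-1` fdom t).
  by apply: mopenI => //; exact: vb_open.
exists s; split=> // b.
have : smooth_at x (fun y => \sum_alpha gt y b alpha * fcoord t (z (h y)) alpha).
  apply: (smooth_at_sum aM) => alpha; apply: smooth_atM.
    by apply: (smooth_on_at oD _ (sgt b alpha)); split.
  apply: (smooth_on_at ot tx); exact: (smooth_on_comp aN sh (vb_open hF ht) (sz t ht alpha)).
move=> [W [oW Wx HW]]; exists (W `&` (fdom s `&` h @^-1` fdom t)); split=> //.
  exact: mopenI.
apply: smooth_on_eq (smooth_on_sub _ HW); [exact: mopenI| |by move=> ? []].
move=> y [_ [sy ty]]; have [gl gr] := Hgt y (conj sy ty).
have [_ /colP/(_ b)] := fibre_inverse (z (h y)) hs ht sy ty gl gr.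
rewrite [X in X = _ -> _]mxE [X in _ = X -> _]mxE /pull_sec => ->.
by apply: eq_bigr => alpha _; congr (_ * _); rewrite mxE.
Qed.

End Morphism.

(** * The complete lift *)

Section Final.
Context {R : realType} {m : nat} {M N : premanifold R m}.
Context (mM : is_manifold M) (mN : is_manifold N).
Context (h : diffeo M N) (eta : diffeo N M) {r p : nat}.
Context {F : vbundle N p} (hF : is_vbundle F) (A : gla h eta F).
Context {V : vbundle M r} (hV : is_vbundle V) (g : vbmorph V F h).
Context (hg : locally_invertible g) (u : sec V) (su : smooth_sec u).

Let aM := manifold_atlas mM.
Let aN := manifold_atlas mN.
Let aT := tot_atlas aM hV.
Let sh : smooth_map h := @dfun_smooth _ _ _ _ h.
Let sh' : smooth_map (dinv h) := @dinv_smooth _ _ _ _ h.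
Let su' := push_smooth mM mN hV hF g su.

(** Related to the anchor of the pushed section by the diffeomorphism [h].  The
    tangent space at [dinv h (h x)] is the same type as that at [x]. *)
Definition base_field : sec (tangent M) :=
  fun x => tmap (dinv h) (anchor A (push_sec g u) (h x)).

Definition bracket_field (v : sec V) : sec V :=
  pull_sec g (bracket A (push_sec g u) (push_sec g v)).

Lemma tderive_base_field x f : smooth_at x f ->
  tderive x (base_field x) f = tderive (h x) (anchor A (push_sec g u) (h x)) (f \o dinv h).
Proof.
move=> sf; have sf' : smooth_at (dinv h (h x)) f by rewrite dfunK.
by have := tderive_tmap aN aM sh' (anchor A (push_sec g u) (h x)) sf'; rewrite dfunK.
Qed.

Lemma act_base_field f x : smooth_fun f ->
  act base_field f x = act (anchor A (push_sec g u)) (f \o dinv h) (h x).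
Proof. by move=> sf; rewrite !actE tderive_base_field //; exact: smooth_fun_at. Qed.

Lemma base_field_smooth : smooth_sec base_field.
Proof.
apply/(smooth_secT aM) => c j hc; have oc := mopen_cdom aM hc.
have sc := smooth_coord aM j hc.
have H := smooth_on_comp aM sh' oc sc.
have oc' := mopen_preimage aM sh' oc.
have H' := smooth_on_comp aN sh oc' (act_smooth aN (anchor_smooth A su') oc' H).
apply: smooth_on_eq (smooth_on_sub _ H') => //.
  by move=> x cx; rewrite tderive_base_field //; exact: smooth_on_at oc cx sc.
by move=> x cx; rewrite /= dfunK.
Qed.

Lemma bracket_field_smooth v : smooth_sec v -> smooth_sec (bracket_field v).
Proof.
move=> sv; apply: (pull_smooth mM mN hV hF hg).
by apply: bracket_smooth => //; exact: (push_smooth mM mN hV hF g sv).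
Qed.

Lemma bracketDr z w w' : smooth_sec z -> smooth_sec w -> smooth_sec w' ->
  bracket A z (fun y => w y + w' y) = fun y => bracket A z w y + bracket A z w' y.
Proof.
move=> sz sw sw'; rewrite (bracket_antisym A sz (smooth_secD hF sw sw')).
have E : (fun y => w y + w' y) = (fun y => 1 *: w y + w' y).
  by apply: functional_extensionality_dep => y; rewrite scale1r.
rewrite E (bracket_linear A) //; apply: functional_extensionality_dep => y.
by rewrite scale1r (bracket_antisym A sz sw) (bracket_antisym A sz sw') opprD.
Qed.

Lemma bracket_fieldD v w : smooth_sec v -> smooth_sec w ->
  bracket_field (fun x => v x + w x) = fun x => bracket_field v x + bracket_field w x.
Proof.
move=> sv sw; have sv' := push_smooth mM mN hV hF g sv.
have sw' := push_smooth mM mN hV hF g sw.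
rewrite /bracket_field (push_secD g v w) bracketDr //.
by apply: functional_extensionality_dep => x; rewrite /pull_sec linearD.
Qed.

(** The Leibniz rule of the bracket, read on [M]. *)
Lemma bracket_fieldZ f v : smooth_fun f -> smooth_sec v ->
  bracket_field (fun x => f x *: v x)
  = fun x => f x *: bracket_field v x + act base_field f x *: v x.
Proof.
move=> sf sv; have sv' := push_smooth mM mN hV hF g sv.
have sf' := smooth_fun_comp aM sh' sf.
rewrite /bracket_field (push_secZ g f v) (bracket_leibniz A su' sv' sf').
apply: functional_extensionality_dep => x.
rewrite /pull_sec linearD !linearZ /= dfunK push_secE act_base_field //.
by rewrite (lker0_lfunK (fibre_injective hV hF hg x)).
Qed.

Lemma lie_derivativeE omega v : Lambda1 omega -> smooth_sec v ->
  lie_derivative A g u omega v = form_derivative base_field bracket_field omega v.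
Proof.
move=> Lo sv; apply/funext => x; rewrite /form_derivative.
by rewrite act_base_field //; exact: (Lambda1_smooth Lo sv).
Qed.

Lemma smooth_hpi : smooth_map (fun w : tot V => h (bproj w)).
Proof.
apply: smooth_map_coord => c hc; have oc := mopen_cdom aN hc.
have oc' := mopen_preimage aN sh oc; have spi := bproj_smooth aM hV.
split; first exact: (mopen_preimage aM spi oc').
move=> j; have sj := smooth_on_comp aN sh oc (smooth_coord aN j hc).
exact: (smooth_on_comp aM spi oc' sj).
Qed.

(** A function on [N] smooth at [h x] is the same as a function on [M] smooth
    at [x], and relatedness of tangent vectors can be tested on such functions;
    this turns relatedness into the condition on [f o pi]. *)
Lemma is_liftP (v : tot V) (w : 'rV[R]_(m + r)) :
  is_lift base_field bracket_field v w <->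
  (tmap (fun w => h (bproj w)) (w : tangent (tot V) v)
     = anchor A (push_sec g u) (h (bproj v)) /\
   forall omega : sec V -> M -> R, Lambda1 omega ->
     tderive v w (hat omega) = hat (lie_derivative A g u omega) v).
Proof.
have hatE omega : Lambda1 omega ->
    hat (lie_derivative A g u omega) = hat (form_derivative base_field bracket_field omega).
  by move=> Lo; apply: eq_hat => z; exact: lie_derivativeE.
have T f : smooth_at (h (bproj v)) f ->
    tderive (h (bproj v)) (tmap (fun w => h (bproj w)) (w : tangent (tot V) v)) f
    = tderive v w (f \o (fun w : tot V => h (bproj w))).
  by move=> sf; exact: (tderive_tmap aT aN smooth_hpi (x := v) w sf).
split=> -[H1 H2]; split; try by move=> omega Lo; rewrite H2 // hatE.
- apply: (tderive_inj aN (x := h (bproj v))) => f sf; rewrite T //.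
  have sfh := smooth_at_comp aN sh sf.
  have Hf := H1 _ sfh; rewrite tderive_base_field // in Hf.
  apply: etrans Hf _.
  by congr tderive; apply/funext => y; rewrite /= dinvK.
- move=> f sf; rewrite tderive_base_field // -H1.
  have sf' : smooth_at (h (bproj v)) (f \o dinv h).
    by apply: (smooth_at_comp aM sh'); rewrite dfunK.
  rewrite T //.
  by congr tderive; apply/funext => y; rewrite /= dfunK.
Qed.

Theorem complete_lift :
  exists! uc : sec (tangent (tot V)),
    [/\ smooth_sec uc,
        (forall v : tot V,
           tmap (fun w => h (bproj w)) (uc v)
           = anchor A (push_sec g u) (h (bproj v))) &
        (forall omega : sec V -> M -> R, Lambda1 omega ->
           forall v : tot V,
             act uc (hat omega) v = hat (lie_derivative A g u omega) v)].
Proof.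
have [uc Huc] := choice (lift_exists mM hV base_field_smooth bracket_field_smooth
  bracket_fieldD bracket_fieldZ).
exists uc; split.
  split.
  - exact: (lift_smooth mM hV base_field_smooth bracket_field_smooth
      bracket_fieldD bracket_fieldZ Huc).
  - by move=> v; have [] := (is_liftP v (uc v)).1 (Huc v).
  - by move=> omega Lo v; have [_ H] := (is_liftP v (uc v)).1 (Huc v); exact: H.
move=> uc' [_ H1 H2]; apply: functional_extensionality_dep => v.
apply: (lift_unique mM hV (Huc v)); apply/is_liftP; split; first exact: H1.
by move=> omega Lo; exact: H2.
Qed.

End Final.

Theorem theorem27 (R : realType) (m r p : nat) (M N : premanifold R m)
    (hM : is_manifold M) (hN : is_manifold N)
    (h : diffeo M N) (eta : diffeo N M)
    (F : vbundle N p) (hF : is_vbundle F) (A : gla h eta F)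
    (E : vbundle M r) (hE : is_vbundle E)
    (g : vbmorph (dual E) F h) (hg : locally_invertible g)
    (u : sec (dual E)) (hu : smooth_sec u) :
  exists! uc : sec (tangent (tot (dual E))),
    [/\ smooth_sec uc,
        (forall v : tot (dual E),
           tmap (fun w => h (bproj w)) (uc v)
           = anchor A (push_sec g u) (h (bproj v))) &
        (forall omega : sec (dual E) -> M -> R, Lambda1 omega ->
           forall v : tot (dual E),
             act uc (hat omega) v = hat (lie_derivative A g u omega) v)].
Proof. exact: (complete_lift hM hN hF A (dual_vbundle hE) hg hu). Qed.
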